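(* Let $V$ be a transitive model of $ZFC^-$ and let $\mathbf{j}: V \preceq \hat{V}$ be an elementary embedding with $\hat{V}$ $\omega$-nonstandard. Let $T \in V$ be a complete countable theory and let $M_0, M_1 \in V$ be two models of $T$. Let $\kappa$ be an uncountable cardinal. Then $\mathbf{j}_{\mathrm{std}}(M_0)$ is $\kappa$-pseudosaturated if and only if $\mathbf{j}_{\mathrm{std}}(M_1)$ is $\kappa$-pseudosaturated.
   Context: $ZFC^-$ denotes $ZFC$ without the powerset axiom, with replacement strengthened to collection and choice strengthened to the well-ordering principle. Convention: every complete countable theory comes with a fixed injection of its symbols into $\omega$, so it is countable in any transitive model of $ZFC^-$ containing it. For $V$ transitive and $\mathbf{j}: V \preceq \hat{V}$ an elementary embedding into a model $(\hat V,\hat\in)$ of $ZFC^-$, $\hat V$ is $\omega$-nonstandard if its $\omega$ (written $\hat\omega$) has nonstandard elements. For an $\mathcal{L}$-structure $M \in V$, $\mathbf{j}_{\mathrm{std}}(M)$ is the $\mathcal{L}$-structure with universe $\{a \in \hat V : a \mathrel{\hat\in} \mathbf{j}(M)\}$ in which each symbol of $\mathcal{L}$ is interpreted as $\mathbf{j}$ of its interpretation in $M$ (e.g. $R^{\mathbf{j}_{\mathrm{std}}(M)} = \{\bar a : \hat V \models \bar a \in \mathbf{j}(R^M)\}$). A set $X \subseteq \hat V$ is pseudofinite if there is $\hat X \in \hat V$ which is finite in the sense of $\hat V$ with $x \mathrel{\hat\in} \hat X$ for all $x \in X$. $\mathbf{j}_{\mathrm{std}}(M)$ is $\kappa$-pseudosaturated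 if for every pseudofinite $A \subseteq \mathbf{j}_{\mathrm{std}}(M)$ with $|A| < \kappa$, every complete type over $A$ (in finitely many variables) is realized in $\mathbf{j}_{\mathrm{std}}(M)$. *)

(* Defs.v *)
From Stdlib Require Import List Wellfounded.
Import ListNotations.

Set Implicit Arguments.

Inductive sform : Type :=
| SMem : nat -> nat -> sform
| SEq  : nat -> nat -> sform
| SNeg : sform -> sform
| SImp : sform -> sform -> sform
| SAll : sform -> sform.

Definition scons {X : Type} (x : X) (e : nat -> X) : nat -> X :=
  fun i => match i with 0 => x | S i => e i end.

Fixpoint ssat {X : Type} (R : X -> X -> Prop) (e : nat -> X) (f : sform) : Prop :=
  match f with
  | SMem i j => R (e i) (e j)
  | SEq i j => e i = e j
  | SNeg g => ~ ssat R e g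
  | SImp g h => ssat R e g -> ssat R e h
  | SAll g => forall x, ssat R (scons x e) g
  end.

Section SetTheory.
Variable X : Type.
Variable R : X -> X -> Prop.   (* R a b  means  a ∈ b *)

Definition is_empty (x : X) : Prop := forall z, ~ R z x.
Definition is_succ (y s : X) : Prop := forall z, R z s <-> (R z y \/ z = y).
Definition upair (p a b : X) : Prop := forall z, R z p <-> (z = a \/ z = b).
(* Kuratowski ordered pair  p = {{a},{a,b}} *)
Definition opair (p a b : X) : Prop :=
  forall z, R z p <-> (upair z a a \/ upair z a b).
Definition rel_in (f a b : X) : Prop := exists p, R p f /\ opair p a b.

Fixpoint is_num (x : X) (k : nat) : Prop :=
  match k with
  | 0 => is_empty x
  | S k' => exists y, is_num y k' /\ is_succ y x
  end.

Definition inductive_set (y : X) : Prop :=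
  (exists e, R e y /\ is_empty e) /\
  (forall z, R z y -> exists s, R s y /\ is_succ z s).

Definition is_omega (w : X) : Prop :=
  inductive_set w /\ forall y, inductive_set y -> forall z, R z w -> R z y.

Definition omega_nonstandard : Prop :=
  exists w x, is_omega w /\ R x w /\ forall k, ~ is_num x k.

Definition ifinite (h : X) : Prop :=
  exists w n f, is_omega w /\ R n w /\
    (forall i, R i n -> exists a, R a h /\ rel_in f i a) /\
    (forall i a a', R i n -> rel_in f i a -> rel_in f i a' -> a = a') /\
    (forall i i' a, R i n -> R i' n -> rel_in f i a -> rel_in f i' a -> i = i') /\
    (forall a, R a h -> exists i, R i n /\ rel_in f i a).

(* the axioms of ZFC^- (no powerset; collection; well-ordering principle),
   written out semantically; schemes quantify over all formulas *)
Definition ax_ext : Prop :=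
  forall x y, (forall z, R z x <-> R z y) -> x = y.
Definition ax_found : Prop :=
  forall x, (exists y, R y x) -> exists y, R y x /\ ~ exists z, R z y /\ R z x.
Definition ax_pair : Prop := forall a b, exists p, upair p a b.
Definition ax_union : Prop :=
  forall x, exists u, forall z, R z u <-> exists y, R z y /\ R y x.
Definition ax_inf : Prop := exists w, inductive_set w.
Definition ax_sep : Prop :=
  forall (phi : sform) (e : nat -> X) (x : X),
    exists y, forall z, R z y <-> (R z x /\ ssat R (scons z e) phi).
Definition ax_coll : Prop :=
  forall (phi : sform) (e : nat -> X) (x : X),
    (forall u, R u x -> exists v, ssat R (scons v (scons u e)) phi) ->
    exists y, forall u, R u x -> exists v, R v y /\ ssat R (scons v (scons u e)) phi.
Definition ax_wo : Prop :=
  forall x, exists r,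
    (forall a, R a x -> ~ rel_in r a a) /\
    (forall a b c, R a x -> R b x -> R c x -> rel_in r a b -> rel_in r b c -> rel_in r a c) /\
    (forall a b, R a x -> R b x -> a = b \/ rel_in r a b \/ rel_in r b a) /\
    (forall s, (forall z, R z s -> R z x) -> (exists z, R z s) ->
       exists m, R m s /\ forall z, R z s -> ~ rel_in r z m).

Definition ZFCminus : Prop :=
  ax_ext /\ ax_found /\ ax_pair /\ ax_union /\ ax_inf /\ ax_sep /\ ax_coll /\ ax_wo.

End SetTheory.

Definition elementary {U W : Type} (E : U -> U -> Prop) (F : W -> W -> Prop)
  (j : U -> W) : Prop :=
  forall (phi : sform) (e : nat -> U), ssat E e phi <-> ssat F (fun i => j (e i)) phi.

(* A countable language: symbols are coded by natural numbers (the fixed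
   injection into ω).  [L k = Some (true, n)] : k is an n-ary function symbol
   (constants are 0-ary function symbols); [L k = Some (false, n)] : k is an
   n-ary relation symbol; [L k = None] : k is not a symbol of L. *)
Definition lang := nat -> option (bool * nat).

Inductive term (P : Type) : Type :=
| tvar : nat -> term P
| tpar : P -> term P
| tfun : nat -> list (term P) -> term P.

Inductive form (P : Type) : Type :=
| fatom : nat -> list (term P) -> form P
| feq : term P -> term P -> form P
| fneg : form P -> form P
| fimp : form P -> form P -> form P
| fall : form P -> form P.

Arguments tvar {P}. Arguments tpar {P}. Arguments tfun {P}.
Arguments fatom {P}. Arguments feq {P}. Arguments fneg {P}.
Arguments fimp {P}. Arguments fall {P}.

Record structure (X : Type) : Type := mkStructure {
  sdom : X -> Prop;
  srel : nat -> list X -> Prop;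
  sfun : nat -> list X -> X -> Prop
}.

Inductive teval {X P : Type} (S : structure X) (v : P -> X) (e : nat -> X)
  : term P -> X -> Prop :=
| te_var : forall i, teval S v e (tvar i) (e i)
| te_par : forall p, teval S v e (tpar p) (v p)
| te_fun : forall k ts xs b,
    Forall2 (teval S v e) ts xs -> sfun S k xs b -> teval S v e (tfun k ts) b.

Fixpoint sat {X P : Type} (S : structure X) (v : P -> X) (e : nat -> X)
  (phi : form P) : Prop :=
  match phi with
  | fatom k ts => exists xs, Forall2 (teval S v e) ts xs /\ srel S k xs
  | feq t1 t2 => exists x, teval S v e t1 x /\ teval S v e t2 x
  | fneg g => ~ sat S v e g
  | fimp g h => sat S v e g -> sat S v e h
  | fall g => forall x, sdom S x -> sat S v (scons x e) g
  end.

Inductive tbound {P : Type} (n : nat) : term P -> Prop :=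
| tb_var : forall i, i < n -> tbound n (tvar i)
| tb_par : forall p, tbound n (tpar p)
| tb_fun : forall k ts, Forall (tbound n) ts -> tbound n (tfun k ts).

Fixpoint fbound {P : Type} (n : nat) (phi : form P) : Prop :=
  match phi with
  | fatom _ ts => Forall (tbound n) ts
  | feq t1 t2 => tbound n t1 /\ tbound n t2
  | fneg g => fbound n g
  | fimp g h => fbound n g /\ fbound n h
  | fall g => fbound (S n) g
  end.

Definition wf_structure {X : Type} (L : lang) (S : structure X) : Prop :=
  (exists x, sdom S x) /\
  (forall k xs, srel S k xs ->
     exists n, L k = Some (false, n) /\ length xs = n /\ Forall (sdom S) xs) /\
  (forall k xs b, sfun S k xs b ->
     exists n, L k = Some (true, n) /\ length xs = n /\ Forall (sdom S) xs /\ sdom S b) /\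
  (forall k n xs, L k = Some (true, n) -> length xs = n -> Forall (sdom S) xs ->
     exists b, sfun S k xs b) /\
  (forall k xs b b', sfun S k xs b -> sfun S k xs b' -> b = b').

Definition sentence := form Empty_set.
Definition noparam {X : Type} : Empty_set -> X := fun z => match z with end.

Definition models {X : Type} (S : structure X) (T : sentence -> Prop) : Prop :=
  forall phi, T phi -> forall e, sat S noparam e phi.

Definition entails (L : lang) (T : sentence -> Prop) (phi : sentence) : Prop :=
  forall (X : Type) (S : structure X), wf_structure L S -> models S T ->
    forall e, sat S noparam e phi.

(* a complete (countable, since symbols are coded in ω) L-theory *)
Definition complete_theory (L : lang) (T : sentence -> Prop) : Prop :=
  (forall phi, T phi -> fbound 0 phi) /\
  (forall phi, fbound 0 phi -> entails L T phi \/ entails L T (fneg phi)).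

Definition complete_type {X : Type} (S : structure X) (A : X -> Prop) (n : nat)
  (p : form {a : X | A a} -> Prop) : Prop :=
  (forall phi, p phi -> fbound n phi) /\
  (forall phi, fbound n phi -> p phi \/ p (fneg phi)) /\
  (forall l, (forall phi, In phi l -> p phi) ->
     exists e, (forall i, sdom S (e i)) /\
               forall phi, In phi l -> sat S (@proj1_sig _ _) e phi).

Definition realized {X : Type} (S : structure X) (A : X -> Prop)
  (p : form {a : X | A a} -> Prop) : Prop :=
  exists e, (forall i, sdom S (e i)) /\ forall phi, p phi -> sat S (@proj1_sig _ _) e phi.

Definition injective {A B : Type} (f : A -> B) : Prop :=
  forall x y, f x = f y -> x = y.
Definition card_lt (A K : Type) : Prop :=
  (exists f : A -> K, injective f) /\ ~ (exists g : K -> A, injective g).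
Definition uncountable (K : Type) : Prop := ~ exists g : K -> nat, injective g.

Section Coding.
Variable X : Type.
Variable R : X -> X -> Prop.

Definition tuple_code (c : X) (xs : list X) : Prop :=
  forall p, R p c <-> exists i a x, nth_error xs i = Some a /\ is_num R x i /\ opair R p x a.

(* Convention: an L-structure M in a model of set theory is an ordered pair
   M = <u, I>, u the universe, I a function with domain (the codes of) the
   symbols of L, I(k) ⊆ u^n for an n-ary relation symbol k, and
   I(k) : u^n → u for an n-ary function symbol k (u^n = tuples coded as above). *)
Definition interp (L : lang) (m : X) (k : nat) (y : X) : Prop :=
  exists u I x, opair R m u I /\ is_num R x k /\ rel_in R I x y.

Definition rel_interp (u : X) (n : nat) (y : X) : Prop :=
  forall c, R c y -> exists xs, length xs = n /\ Forall (fun a => R a u) xs /\ tuple_code c xs.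

Definition fun_interp (u : X) (n : nat) (y : X) : Prop :=
  (forall p, R p y -> exists c b xs, opair R p c b /\ tuple_code c xs /\
       length xs = n /\ Forall (fun a => R a u) xs /\ R b u) /\
  (forall xs, length xs = n -> Forall (fun a => R a u) xs ->
       exists c b, tuple_code c xs /\ rel_in R y c b) /\
  (forall c b b', rel_in R y c b -> rel_in R y c b' -> b = b').

Definition lang_in (L : lang) : Prop :=
  exists s, forall z, R z s <->
    exists k kd n x q xd xn, L k = Some (kd, n) /\ is_num R x k /\
      is_num R xd (if kd then 1 else 0) /\ is_num R xn n /\
      opair R q xd xn /\ opair R z x q.

Definition is_Lstructure (L : lang) (m : X) : Prop :=
  lang_in L /\
  exists u I, opair R m u I /\ (exists a, R a u) /\
    (forall p, R p I -> exists k x y, L k <> None /\ is_num R x k /\ opair R p x y) /\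
    (forall k x y y', is_num R x k -> rel_in R I x y -> rel_in R I x y' -> y = y') /\
    (forall k kd n, L k = Some (kd, n) ->
       exists x y, is_num R x k /\ rel_in R I x y /\
         (if kd then fun_interp u n y else rel_interp u n y)).

Definition decode (L : lang) (m : X) : structure X :=
  {| sdom := fun a => exists u I, opair R m u I /\ R a u;
     srel := fun k xs => exists n y c, L k = Some (false, n) /\ length xs = n /\
               interp L m k y /\ tuple_code c xs /\ R c y;
     sfun := fun k xs b => exists n y c, L k = Some (true, n) /\ length xs = n /\
               interp L m k y /\ tuple_code c xs /\ rel_in R y c b |}.

Definition pseudofinite (A : X -> Prop) : Prop :=
  exists h, ifinite R h /\ forall a, A a -> R a h.

Definition pseudosaturated (S : structure X) (K : Type) : Prop :=
  forall A : X -> Prop, (forall a, A a -> sdom S a) -> pseudofinite A ->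
    card_lt {a : X | A a} K ->
    forall (n : nat) (p : form {a : X | A a} -> Prop),
      complete_type S A n p -> realized S A p.

End Coding.

Definition j_std {U W : Type} (F : W -> W -> Prop) (j : U -> W) (L : lang) (M : U)
  : structure W := decode F L (j M).

(* Main.v *)
(** One first-order formula of set theory, transferred along [j], expresses that [M0] and
    [M1] look alike: for every [n] in [omega] and every finite [h] there is a set [J] of
    pairs (level, partial map from [M0] to [M1]) such that maps of level [x + 1] extend back
    and forth to maps of level [x], all maps preserve the first [n] symbols, and some map of
    level [n] has every element of [M1] in [h] in its range. In the well-founded model
    [omega] is standard, and this is the Ehrenfeucht-Fraïssé theorem for the elementarily
    equivalent [M0] and [M1]. In the target model take [n] nonstandard: the maps of
    nonstandard level form a genuine back-and-forth system, so a type over a pseudofinite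
    set can be carried along a map covering the set, realized on the other side, and the
    realization carried back. *)

Require Import Defs.
From Stdlib Require Import List Wellfounded.
From Stdlib Require Import Lia Arith Classical ClassicalEpsilon.
Import ListNotations.
Set Implicit Arguments.

(** * Definability *)

(** The transferred formula speaks of games only. The theory [T] and truth in the two structures are
    never coded inside set theory; they are used only in the well-founded model, where numbers of
    rounds, numbers of symbols and finite sets are finite from outside as well. Two obstacles shape
    the details. Without powerset there is no ready-made set of all partial maps, so [J] is
    assembled one level at a time: collection gives a superset of the maps of a fixed finite size,
    and separation cuts out the good ones. In the target model, the image of the language may
    contain nonstandard symbols, so the image of a structure need not satisfy [is_Lstructure] there;
    only facts about one standard symbol at a time are transferred. The formula also puts the domain
    of the starting map inside an internally finite set, because the parameter set pulled back along
    that map must again be pseudofinite. *)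

Definition definable (P : forall X : Type, (X -> X -> Prop) -> (nat -> X) -> Prop) : Prop :=
  exists phi, forall X (R : X -> X -> Prop) e, ssat R e phi <-> P X R e.

Lemma definable_mem i j : definable (fun X R e => R (e i) (e j)).
Proof. exists (SMem i j). reflexivity. Qed.

Lemma definable_eq i j : definable (fun X R e => e i = e j).
Proof. exists (SEq i j). reflexivity. Qed.

Lemma definable_not P : definable P -> definable (fun X R e => ~ P X R e).
Proof. intros [p H]. exists (SNeg p). intros. simpl. rewrite H. reflexivity. Qed.

Lemma definable_imp P Q : definable P -> definable Q ->
  definable (fun X R e => P X R e -> Q X R e).
Proof.
  intros [p H] [q H']. exists (SImp p q). intros. simpl. rewrite H, H'. reflexivity.
Qed.

Lemma definable_ext P Q : (forall X R e, P X R e <-> Q X R e) ->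
  definable P -> definable Q.
Proof. intros HPQ [p H]. exists p. intros. rewrite H. apply HPQ. Qed.

Lemma definable_and P Q : definable P -> definable Q ->
  definable (fun X R e => P X R e /\ Q X R e).
Proof.
  intros HP HQ. apply definable_ext with (fun X R e => ~ (P X R e -> ~ Q X R e)).
  - intros. tauto.
  - apply definable_not, definable_imp; [|apply definable_not]; assumption.
Qed.

Lemma definable_or P Q : definable P -> definable Q ->
  definable (fun X R e => P X R e \/ Q X R e).
Proof.
  intros HP HQ. apply definable_ext with (fun X R e => ~ P X R e -> Q X R e).
  - intros. tauto.
  - apply definable_imp; [apply definable_not|]; assumption.
Qed.

Lemma definable_iff P Q : definable P -> definable Q ->
  definable (fun X R e => P X R e <-> Q X R e).
Proof. intros HP HQ. apply definable_and; apply definable_imp; assumption. Qed.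

Lemma definable_all (Q : forall X : Type, (X -> X -> Prop) -> X -> (nat -> X) -> Prop) :
  definable (fun X R e => Q X R (e 0) (fun i => e (S i))) ->
  definable (fun X R e => forall x : X, Q X R x e).
Proof.
  intros [p H]. exists (SAll p). intros. simpl. split; intros G x.
  - apply (proj1 (H X R (scons x e)) (G x)).
  - apply H. apply G.
Qed.

Lemma definable_ex (Q : forall X : Type, (X -> X -> Prop) -> X -> (nat -> X) -> Prop) :
  definable (fun X R e => Q X R (e 0) (fun i => e (S i))) ->
  definable (fun X R e => exists x : X, Q X R x e).
Proof.
  intros H. apply definable_ext with (fun X R e => ~ forall x : X, ~ Q X R x e).
  - intros. split.
    + intros G. apply not_all_not_ex. exact G.
    + intros [x Hx] G. exact (G x Hx).
  - apply definable_not.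
    apply (definable_all (fun X R x e => ~ Q X R x e)). apply definable_not, H.
Qed.

(** Hypotheses come before the connectives, so that induction hypotheses and definability facts
    added with [pose proof] close their goals unopened. Negation precedes implication, since [~ A]
    unfolds to [A -> False] and no rule treats [False]. *)
Ltac definability_step := cbv beta; first
  [ apply definable_mem | apply definable_eq
  | match goal with H : _ |- _ => apply H end
  | apply definable_all | apply definable_ex | apply definable_iff | apply definable_and
  | apply definable_or | apply definable_not | apply definable_imp ].

Ltac definability := repeat definability_step.

Lemma definable_num k : forall i, definable (fun X R e => is_num R (e i) k).
Proof.
  induction k; intros i; simpl; unfold is_empty, is_succ; definability.
Qed.

(** Works because [definable] chooses the formula before the model: the same formula expresses [P]
    on both sides of [j]. Predicates can thus be written semantically and formulas are never
    displayed. *)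
Lemma elementary_transfer U W (E : U -> U -> Prop) (F : W -> W -> Prop) j
  (Hj : elementary E F j) P (HP : definable P) e :
  P U E e <-> P W F (fun i => j (e i)).
Proof. destruct HP as [p H]. rewrite <- !H. apply Hj. Qed.

Definition env {X} (d : X) (l : list X) : nat -> X := fold_right scons (fun _ => d) l.

(** * Elementary set theory in models of ZFC without powerset *)

Section Sets.
Variables (X : Type) (R : X -> X -> Prop).
Hypothesis HZ : ZFCminus R.

Lemma set_ext x y : (forall z, R z x <-> R z y) -> x = y.
Proof. apply HZ. Qed.

Lemma pair_exists a b : exists p, upair R p a b.
Proof. apply HZ. Qed.

Lemma union_exists x : exists u, forall z, R z u <-> exists y, R z y /\ R y x.
Proof. apply HZ. Qed.

Lemma separation P (HP : definable P) e x :
  exists y, forall z, R z y <-> R z x /\ P X R (scons z e).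
Proof.
  destruct HP as [p H]. destruct HZ as (_ & _ & _ & _ & _ & Hs & _).
  destruct (Hs p e x) as [y Hy]. exists y. intros z. rewrite Hy, H. reflexivity.
Qed.

Lemma collection P (HP : definable P) e x :
  (forall u, R u x -> exists v, P X R (scons v (scons u e))) ->
  exists y, forall u, R u x -> exists v, R v y /\ P X R (scons v (scons u e)).
Proof.
  destruct HP as [p H]. destruct HZ as (_ & _ & _ & _ & _ & _ & Hs & _).
  intros Hx. destruct (Hs p e x) as [y Hy].
  - intros u Hu. destruct (Hx u Hu) as [v Hv]. exists v. apply H, Hv.
  - exists y. intros u Hu. destruct (Hy u Hu) as (v & ? & Hv).
    exists v. split; [assumption|]. apply H, Hv.
Qed.

(** Collection is applied to [y] for each fixed [a], then to [x] to gather the resulting sets, and a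
    union flattens them. This replaces the usual construction of products; it bounds the witnesses
    without isolating them. *)
Lemma collection2 (P : forall X : Type, (X -> X -> Prop) -> X -> X -> X -> Prop)
  (HP : forall i j k, definable (fun X R e => P X R (e i) (e j) (e k))) x y :
  (forall a b, R a x -> R b y -> exists v, P X R v a b) ->
  exists Z, forall a b, R a x -> R b y -> exists v, R v Z /\ P X R v a b.
Proof.
  intros H.
  destruct (@collection (fun X R e => forall b, R b (e 2) ->
      exists v, R v (e 0) /\ P X R v (e 1) b)) with (e := env x [y]) (x := x) as [Y HY].
  - definability.
  - intros a Ha. simpl.
    destruct (@collection (fun X R e => P X R (e 0) (e 2) (e 1)))
      with (e := env x [a]) (x := y) as [Z HZ'].
    + definability.
    + intros b Hb. simpl. apply H; assumption.
    + exists Z. apply HZ'.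
  - destruct (union_exists Y) as [Z HZ']. exists Z. intros a b Ha Hb.
    destruct (HY a Ha) as (Za & HZa & G). destruct (G b Hb) as (v & Hv & Hv').
    exists v. split; [|assumption]. apply HZ'. simpl in *. eauto.
Qed.

Lemma binary_union x y : exists u, forall z, R z u <-> R z x \/ R z y.
Proof.
  destruct (pair_exists x y) as [p Hp]. destruct (union_exists p) as [u Hu].
  exists u. intros z. rewrite Hu. split.
  - intros (w & Hz & Hw). apply Hp in Hw. destruct Hw; subst; auto.
  - intros [Hz|Hz]; [exists x|exists y]; (split; [assumption|]); apply Hp; auto.
Qed.

Lemma empty_exists : exists e, is_empty R e.
Proof.
  destruct HZ as (_ & _ & _ & _ & [w [(e & _ & He) _]] & _). eauto.
Qed.

Lemma adjoin_exists x a : exists u, forall z, R z u <-> R z x \/ z = a.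
Proof.
  destruct (pair_exists a a) as [s Hs]. destruct (binary_union x s) as [u Hu].
  exists u. intros z. rewrite Hu, (Hs z). tauto.
Qed.

Lemma list_set_exists l : exists u, forall z, R z u <-> In z l.
Proof.
  induction l as [|a l [u Hu]].
  - destruct empty_exists as [e He]. exists e. intros z. split; [apply He|intros []].
  - destruct (adjoin_exists u a) as [v Hv]. exists v. intros z. rewrite Hv, Hu. simpl.
    split; intros [?|?]; auto.
Qed.

Lemma upair_unique p q a b : upair R p a b -> upair R q a b -> p = q.
Proof. intros Hp Hq. apply set_ext. intros z. rewrite (Hp z), (Hq z). reflexivity. Qed.

Lemma upair_inj p a b c d : upair R p a b -> upair R p c d ->
  (a = c /\ b = d) \/ (a = d /\ b = c).
Proof.
  intros Hp Hq.
  assert (Ha : a = c \/ a = d) by (apply Hq, Hp; auto).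
  assert (Hb : b = c \/ b = d) by (apply Hq, Hp; auto).
  assert (Hc : c = a \/ c = b) by (apply Hp, Hq; auto).
  assert (Hd : d = a \/ d = b) by (apply Hp, Hq; auto).
  intuition congruence.
Qed.

(** [opair] describes the members of [p] only by a property. Naming the two members reduces
    injectivity of pairs to [upair_inj]. *)
Lemma opair_upair p a b : opair R p a b <->
  exists s t, upair R s a a /\ upair R t a b /\ upair R p s t.
Proof.
  split.
  - intros Hp. destruct (pair_exists a a) as [s Hs]. destruct (pair_exists a b) as [t Ht].
    exists s, t. split; [exact Hs|split; [exact Ht|intros z; split]].
    + intros Hz. apply Hp in Hz. destruct Hz as [Hz|Hz].
      * left. exact (upair_unique Hz Hs).
      * right. exact (upair_unique Hz Ht).
    + intros Hz. apply Hp. destruct Hz; subst; auto.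
  - intros (s & t & Hs & Ht & Hp) z. split.
    + intros Hz. apply Hp in Hz. destruct Hz; subst; auto.
    + intros Hz. apply Hp. destruct Hz as [Hz|Hz].
      * left. exact (upair_unique Hz Hs).
      * right. exact (upair_unique Hz Ht).
Qed.

Lemma opair_exists a b : exists p, opair R p a b.
Proof.
  destruct (pair_exists a a) as [s Hs]. destruct (pair_exists a b) as [t Ht].
  destruct (pair_exists s t) as [p Hp]. exists p. apply opair_upair. eauto.
Qed.

Lemma opair_unique p q a b : opair R p a b -> opair R q a b -> p = q.
Proof. intros Hp Hq. apply set_ext. intros z. rewrite (Hp z), (Hq z). reflexivity. Qed.

Lemma opair_inj p a b c d : opair R p a b -> opair R p c d -> a = c /\ b = d.
Proof.
  rewrite !opair_upair. intros (s & t & Hs & Ht & Hp) (s' & t' & Hs' & Ht' & Hp').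
  destruct (upair_inj Hp Hp') as [[-> ->]|[-> ->]].
  - destruct (upair_inj Hs Hs'), (upair_inj Ht Ht'); intuition congruence.
  - destruct (upair_inj Hs Ht'), (upair_inj Ht Hs'); intuition congruence.
Qed.

Lemma not_mem_self {x} : ~ R x x.
Proof.
  intros H. destruct (list_set_exists [x]) as [s Hs].
  destruct HZ as (_ & Hf & _). destruct (Hf s) as (y & Hy & Hy').
  - exists x. apply Hs. simpl. auto.
  - apply Hs in Hy. destruct Hy as [<-|[]]. apply Hy'. exists x. split; [assumption|].
    apply Hs. simpl. auto.
Qed.

Lemma mem_asym {x y} : R x y -> R y x -> False.
Proof.
  intros H H'. destruct (list_set_exists [x; y]) as [s Hs].
  destruct HZ as (_ & Hf & _). destruct (Hf s) as (z & Hz & Hz').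
  - exists x. apply Hs. simpl. auto.
  - apply Hs in Hz. destruct Hz as [<-|[<-|[]]]; apply Hz'; [exists y|exists x];
      (split; [assumption|]); apply Hs; simpl; auto.
Qed.

Lemma succ_inj x y s : is_succ R x s -> is_succ R y s -> x = y.
Proof.
  intros Hx Hy.
  assert (H : R x y \/ x = y) by (apply Hy, Hx; auto).
  assert (H' : R y x \/ y = x) by (apply Hx, Hy; auto).
  destruct H as [H|]; [|assumption]. destruct H' as [H'|]; [|congruence].
  destruct (mem_asym H H').
Qed.

Lemma succ_unique x s t : is_succ R x s -> is_succ R x t -> s = t.
Proof. intros Hs Ht. apply set_ext. intros z. rewrite (Hs z), (Ht z). reflexivity. Qed.

Lemma succ_exists x : exists s, is_succ R x s.
Proof. apply adjoin_exists. Qed.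

Lemma num_exists k : exists x, is_num R x k.
Proof.
  induction k as [|k [x Hx]]; simpl; [apply empty_exists|].
  destruct (succ_exists x) as [s Hs]. eauto.
Qed.

Lemma num_unique {k x y} : is_num R x k -> is_num R y k -> x = y.
Proof.
  revert x y. induction k; simpl; intros x y.
  - intros Hx Hy. apply set_ext. intros z. split; intros Hz; [destruct (Hx z Hz)|destruct (Hy z Hz)].
  - intros (x' & Hx & Sx) (y' & Hy & Sy). rewrite (IHk _ _ Hx Hy) in Sx.
    exact (succ_unique Sx Sy).
Qed.

Lemma mem_num {k x} z : is_num R x k -> (R z x <-> exists i, i < k /\ is_num R z i).
Proof.
  revert x z. induction k; simpl; intros x z Hx.
  - split; [intros Hz; destruct (Hx z Hz)|intros (i & Hi & _); lia].
  - destruct Hx as (y & Hy & Hs). rewrite (Hs z), (IHk y z Hy). split.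
    + intros [(i & Hi & Hz)| ->]; [exists i; split; [lia|assumption]|].
      exists k. split; [lia|assumption].
    + intros (i & Hi & Hz). destruct (Nat.eq_dec i k) as [->|].
      * right. exact (num_unique Hz Hy).
      * left. exists i. split; [lia|assumption].
Qed.

Lemma num_inj {x k l} : is_num R x k -> is_num R x l -> k = l.
Proof.
  intros Hk Hl. destruct (lt_eq_lt_dec k l) as [[H|H]|H]; [|assumption|]; exfalso;
    apply (@not_mem_self x).
  - apply (mem_num _ Hl). eauto.
  - apply (mem_num _ Hk). eauto.
Qed.

Lemma num_succ {x y k} : is_num R x k -> is_succ R x y -> is_num R y (S k).
Proof. intros; simpl; eauto. Qed.

(** Holds even if [w] has nonstandard elements, because [P] is definable: separation forms the
    subset of [w] where [P] holds, and this subset is inductive. *)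
Lemma omega_induction (P : forall X : Type, (X -> X -> Prop) -> X -> Prop)
  (HP : forall i, definable (fun X R e => P X R (e i))) w (Hw : is_omega R w) :
  (forall x, R x w -> is_empty R x -> P X R x) ->
  (forall x y, R x w -> R y w -> is_succ R x y -> P X R x -> P X R y) ->
  forall x, R x w -> P X R x.
Proof.
  intros H0 HS. destruct (@separation (fun X R e => P X R (e 0))) with (e := env w []) (x := w)
    as [y Hy]. { definability. }
  intros x Hx. destruct Hw as [[(e0 & He & He') Hi] Hm]. apply (Hy x). apply Hm; [|assumption].
  split.
  - exists e0. split; [|assumption]. apply Hy. split; [assumption|]. simpl. auto.
  - intros z Hz. apply Hy in Hz. destruct Hz as [Hz Pz]. destruct (Hi z Hz) as (s & Hs & Hs').
    exists s. split; [|assumption]. apply Hy. simpl in *. eauto.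
Qed.

(** The property has [w] as a parameter, which the closed predicates of [omega_induction] do not
    allow, so minimality of [w] is applied by hand. *)
Lemma omega_cases w (Hw : is_omega R w) {x} : R x w ->
  is_empty R x \/ exists y, R y w /\ is_succ R y x.
Proof.
  intros Hx. apply NNPP. intros Hn.
  destruct (@separation (fun X R e => ~ (is_empty R (e 0) \/ exists y, R y (e 1) /\ is_succ R y (e 0))))
    with (e := env w [w]) (x := w) as [y Hy]. { unfold is_empty, is_succ. definability. }
  destruct (@separation (fun X R e => ~ R (e 0) (e 1))) with (e := env w [y]) (x := w)
    as [v Hv]. { definability. }
  assert (Hvw : R x v).
  { destruct Hw as [[(e0 & He & He') Hi] Hm]. apply Hm; [|assumption]. split.
    - exists e0. split; [|assumption]. apply Hv. split; [assumption|]. simpl. intros H.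
      apply Hy in H. apply H. simpl. auto.
    - intros z Hz. apply Hv in Hz. destruct Hz as [Hz _]. destruct (Hi z Hz) as (s & Hs & Hs').
      exists s. split; [|assumption]. apply Hv. split; [assumption|]. simpl. intros H.
      apply Hy in H. apply H. simpl. eauto. }
  apply Hv in Hvw. apply (proj2 Hvw). simpl. apply Hy. simpl. auto.
Qed.

Lemma num_in_nonstandard w (Hw : is_omega R w) {k x n} : is_num R x k ->
  R n w -> (forall l, ~ is_num R n l) -> R x n.
Proof.
  revert x n. induction k; intros x n Hx Hn Hns.
  - assert (H : is_empty R n \/ exists e, R e n /\ is_empty R e).
    { revert n Hn Hns. intros n Hn _. revert n Hn.
      apply (@omega_induction (fun X R n => is_empty R n \/ exists e, R e n /\ is_empty R e)).
      - unfold is_empty. intros. definability.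
      - assumption.
      - auto.
      - intros n m _ _ Hs [He|(e & He & He')]; right.
        + exists n. split; [|assumption]. apply Hs. auto.
        + exists e. split; [|assumption]. apply Hs. auto. }
    destruct H as [H|(e & He & He')]; [destruct (Hns 0); exact H|].
    rewrite (@num_unique 0 x e); auto.
  - destruct Hx as (y & Hy & Hs).
    destruct (omega_cases Hw Hn) as [H|(m & Hm & Hsm)]; [destruct (Hns 0); exact H|].
    assert (Hmn : forall l, ~ is_num R m l).
    { intros l Hl. apply (Hns (S l)). exists m. auto. }
    (* If [z] is below [m], then its successor is at most [m]. The induction is internal, because
       [m] is nonstandard where this is applied. *)
    assert (Q : forall m, R m w -> forall z z', R z m -> is_succ R z z' -> R z' m \/ z' = m).
    { apply (@omega_induction (fun X R m => forall z z', R z m -> is_succ R z z' -> R z' m \/ z' = m)).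
      - unfold is_succ. intros. definability.
      - assumption.
      - intros a _ Ha z z' Hz. destruct (Ha z Hz).
      - intros a b _ _ Hab IH z z' Hz Hz'. apply Hab in Hz. destruct Hz as [Hz| ->].
        + left. apply Hab. eapply IH; eassumption.
        + right. exact (succ_unique Hz' Hab). }
    apply Hsm. eapply Q; try eassumption. apply (IHk y m); assumption.
Qed.

Lemma nonstandard_pred w (Hw : is_omega R w) {n} : R n w -> (forall l, ~ is_num R n l) ->
  exists m, R m w /\ (forall l, ~ is_num R m l) /\ is_succ R m n.
Proof.
  intros Hn Hns. destruct (omega_cases Hw Hn) as [H|(m & Hm & Hs)]; [destruct (Hns 0); exact H|].
  exists m. repeat split; auto; try apply Hs. intros l Hl. apply (Hns (S l)). exists m. auto.
Qed.

Lemma tuple_code_exists xs : exists c, tuple_code R c xs.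
Proof.
  (* The first index [k] is general so that the tail of a list can be coded from position [S k]
     on. *)
  assert (H : forall xs k, exists l, forall p, In p l <->
    exists i a x, nth_error xs i = Some a /\ is_num R x (k + i) /\ opair R p x a).
  { clear xs. induction xs as [|a xs IH]; intros k.
    - exists []. intros p. split; [intros []|intros ([|] & a & x & H & _); discriminate].
    - destruct (IH (S k)) as [l Hl]. destruct (num_exists k) as [x Hx].
      destruct (opair_exists x a) as [q Hq]. exists (q :: l). intros p. simpl. rewrite Hl. split.
      + intros [<-|(i & b & y & H & Hy & Hp)].
        * exists 0, a, x. rewrite Nat.add_0_r. auto.
        * exists (S i), b, y. rewrite Nat.add_succ_r. auto.
      + intros ([|i] & b & y & H & Hy & Hp); simpl in H.
        * left. injection H as <-. rewrite Nat.add_0_r in Hy.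
          rewrite (num_unique Hy Hx) in Hp. exact (opair_unique Hq Hp).
        * right. exists i, b, y. rewrite Nat.add_succ_r in Hy. auto. }
  destruct (H xs 0) as [l Hl]. destruct (list_set_exists l) as [c Hc].
  exists c. intros p. rewrite Hc, Hl. reflexivity.
Qed.

Lemma tuple_code_unique c d xs : tuple_code R c xs -> tuple_code R d xs -> c = d.
Proof. intros Hc Hd. apply set_ext. intros z. rewrite (Hc z), (Hd z). reflexivity. Qed.

Lemma tuple_code_nth {c xs p x a i} : tuple_code R c xs -> is_num R x i -> opair R p x a ->
  (R p c <-> nth_error xs i = Some a).
Proof.
  intros Hc Hx Hp. rewrite (Hc p). split.
  - intros (i' & a' & x' & H & Hx' & Hp'). destruct (opair_inj Hp Hp'); subst.
    rewrite (num_inj Hx Hx'). assumption.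
  - intros H. eauto 6.
Qed.

Lemma tuple_code_inj c xs ys : tuple_code R c xs -> tuple_code R c ys -> xs = ys.
Proof.
  intros Hx Hy. apply nth_error_ext. intros i.
  destruct (num_exists i) as [x Hi].
  assert (H : forall a, nth_error xs i = Some a <-> nth_error ys i = Some a).
  { intros a. destruct (opair_exists x a) as [p Hp].
    rewrite <- (tuple_code_nth Hx Hi Hp), <- (tuple_code_nth Hy Hi Hp). reflexivity. }
  destruct (nth_error xs i) as [a|].
  - symmetry. apply H. reflexivity.
  - destruct (nth_error ys i) as [a|]; [|reflexivity]. apply H. reflexivity.
Qed.

End Sets.

(** * Back-and-forth systems *)

Section TermInd.
Variables (P : Type) (Q : term P -> Prop).
Hypothesis Hvar : forall i, Q (tvar i).
Hypothesis Hpar : forall p, Q (tpar p).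
Hypothesis Hfun : forall k ts, Forall Q ts -> Q (tfun k ts).

Fixpoint term_nested_ind (t : term P) : Q t :=
  match t with
  | tvar i => Hvar i
  | tpar p => Hpar p
  | tfun k ts => Hfun k ((fix go ts : Forall Q ts :=
      match ts with
      | [] => Forall_nil Q
      | t :: ts => Forall_cons t (term_nested_ind t) (go ts)
      end) ts)
  end.
End TermInd.

(** Function symbols are compared as graphs, without totality or arities. The fields [bf_cod0] and
    [bf_cod1] place function values in the domains, so that such a value can itself be matched by a
    back or forth step. *)
Record back_and_forth {X0 X1 : Type} (S0 : structure X0) (S1 : structure X1)
  (B : (X0 -> X1 -> Prop) -> Prop) : Prop := {
  bf_dom : forall G a b, B G -> G a b -> sdom S0 a /\ sdom S1 b;
  bf_eq : forall G a b a' b', B G -> G a b -> G a' b' -> (a = a' <-> b = b');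
  bf_rel : forall G k xs ys, B G -> Forall2 G xs ys -> (srel S0 k xs <-> srel S1 k ys);
  bf_fun : forall G k xs ys a b, B G -> Forall2 G xs ys -> G a b ->
    (sfun S0 k xs a <-> sfun S1 k ys b);
  bf_cod0 : forall k xs a, sfun S0 k xs a -> sdom S0 a;
  bf_cod1 : forall k xs b, sfun S1 k xs b -> sdom S1 b;
  bf_forth : forall G a, B G -> sdom S0 a ->
    exists G' b, B G' /\ (forall a b, G a b -> G' a b) /\ G' a b;
  bf_back : forall G b, B G -> sdom S1 b ->
    exists G' a, B G' /\ (forall a b, G a b -> G' a b) /\ G' a b
}.

Arguments bf_dom {X0 X1 S0 S1 B} _ {G a b} _ _.
Arguments bf_eq {X0 X1 S0 S1 B} _ {G a b a' b'} _ _ _.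
Arguments bf_rel {X0 X1 S0 S1 B} _ {G} k {xs ys} _ _.
Arguments bf_fun {X0 X1 S0 S1 B} _ {G} k {xs ys a b} _ _ _.
Arguments bf_cod0 {X0 X1 S0 S1 B} _ {k xs a} _.
Arguments bf_cod1 {X0 X1 S0 S1 B} _ {k xs b} _.
Arguments bf_forth {X0 X1 S0 S1 B} _ {G} a _ _.
Arguments bf_back {X0 X1 S0 S1 B} _ {G} b _ _.

Definition flip_system {X0 X1 : Type} (B : (X0 -> X1 -> Prop) -> Prop)
  (G : X1 -> X0 -> Prop) : Prop := B (fun a b => G b a).

Lemma Forall2_flip A B (G : A -> B -> Prop) xs ys :
  Forall2 G xs ys -> Forall2 (fun b a => G a b) ys xs.
Proof. induction 1; constructor; assumption. Qed.

Lemma Forall2_mono A B (G G' : A -> B -> Prop) (H : forall a b, G a b -> G' a b) xs ys :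
  Forall2 G xs ys -> Forall2 G' xs ys.
Proof. induction 1; constructor; auto. Qed.

(** Lets the lemmas on terms and atomic formulas be proved in one direction only; their converses
    are the same lemmas for the flipped system. *)
Lemma back_and_forth_flip X0 X1 (S0 : structure X0) (S1 : structure X1) B :
  back_and_forth S0 S1 B -> back_and_forth S1 S0 (flip_system B).
Proof.
  intros [Hd He Hr Hf H0 H1 Hfo Hba]. unfold flip_system. split; intros.
  - destruct (Hd _ _ _ H H2). auto.
  - symmetry. eapply (He _ _ _ _ _ H); assumption.
  - symmetry. apply (Hr _ k ys xs H). apply Forall2_flip in H2. assumption.
  - symmetry. apply (Hf _ k ys xs _ _ H); [|assumption]. apply Forall2_flip in H2. assumption.
  - eauto.
  - eauto.
  - destruct (Hba _ a H H2) as (G' & b & ? & ? & ?). exists (fun b a => G' a b), b. auto.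
  - destruct (Hfo _ b H H2) as (G' & a & ? & ? & ?). exists (fun b a => G' a b), a. auto.
Qed.

Definition matching {X0 X1 P : Type} (G : X0 -> X1 -> Prop) (n : nat)
  (v0 : P -> X0) (v1 : P -> X1) (e0 : nat -> X0) (e1 : nat -> X1) : Prop :=
  (forall p, G (v0 p) (v1 p)) /\ (forall i, i < n -> G (e0 i) (e1 i)).

Lemma matching_mono X0 X1 P (G G' : X0 -> X1 -> Prop) n (v0 : P -> X0) (v1 : P -> X1) e0 e1 :
  (forall a b, G a b -> G' a b) -> matching G n v0 v1 e0 e1 -> matching G' n v0 v1 e0 e1.
Proof. intros H [Hv He]. split; auto. Qed.

Lemma matching_flip X0 X1 P (G : X0 -> X1 -> Prop) n (v0 : P -> X0) (v1 : P -> X1) e0 e1 :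
  matching G n v0 v1 e0 e1 -> matching (fun b a => G a b) n v1 v0 e1 e0.
Proof. exact (fun H => H). Qed.

Lemma matching_scons X0 X1 P (G : X0 -> X1 -> Prop) n (v0 : P -> X0) (v1 : P -> X1) e0 e1 a b :
  matching G n v0 v1 e0 e1 -> G a b -> matching G (S n) v0 v1 (scons a e0) (scons b e1).
Proof.
  intros [Hv He] Hab. split; [assumption|]. intros [|i] Hi; simpl; [assumption|].
  apply He. lia.
Qed.

Section Forth.
Variables (X0 X1 P : Type) (S0 : structure X0) (S1 : structure X1).
Variable B : (X0 -> X1 -> Prop) -> Prop.
Hypothesis HB : back_and_forth S0 S1 B.
Variables (n : nat) (v0 : P -> X0) (v1 : P -> X1) (e0 : nat -> X0) (e1 : nat -> X1).

(** The map must be allowed to grow: values of subterms need not lie in the domain of [G]. *)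
Definition term_forth (t : term P) : Prop :=
  forall G x, B G -> matching G n v0 v1 e0 e1 -> teval S0 v0 e0 t x ->
  exists G' y, B G' /\ (forall a b, G a b -> G' a b) /\ G' x y /\ teval S1 v1 e1 t y.

Lemma term_list_forth ts : Forall term_forth ts ->
  forall G xs, B G -> matching G n v0 v1 e0 e1 -> Forall2 (teval S0 v0 e0) ts xs ->
  exists G' ys, B G' /\ (forall a b, G a b -> G' a b) /\
    Forall2 G' xs ys /\ Forall2 (teval S1 v1 e1) ts ys.
Proof.
  induction 1 as [|t ts Ht _ IH]; intros G xs HG Hm Hts;
    inversion Hts as [|? z ? xs' Hz Hzs]; subst.
  - exists G, []. auto.
  - destruct (Ht G z HG Hm Hz) as (G1 & y & HG1 & Hs1 & Hzy & Hy).
    destruct (IH G1 xs' HG1 (matching_mono _ Hs1 Hm) Hzs)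
      as (G2 & ys & HG2 & Hs2 & Hzys & Hys).
    exists G2, (y :: ys). auto 8.
Qed.

Lemma teval_forth t : tbound n t -> term_forth t.
Proof.
  induction t as [i|p|k ts IH] using term_nested_ind; intros Hb G x HG Hm Ht.
  - inversion Hb; inversion Ht; subst. exists G, (e1 i). repeat split; auto.
    + apply Hm. assumption.
    + constructor.
  - inversion Ht; subst. exists G, (v1 p). repeat split; auto.
    + apply Hm.
    + constructor.
  - inversion Hb as [| |? ? Hb']; inversion Ht as [| |? ? xs ? Hts Hk]; subst.
    assert (IH' : Forall term_forth ts).
    { rewrite Forall_forall in *. auto. }
    destruct (term_list_forth IH' HG Hm Hts) as (G1 & ys & HG1 & Hs1 & Hxy & Hys).
    (* The partner [y] of the value [x] is found by a forth step; only afterwards does [bf_fun] show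
       that [y] is the value of the term in [S1]. *)
    destruct (bf_forth HB x HG1 (bf_cod0 HB Hk)) as (G2 & y & HG2 & Hs2 & Hy).
    exists G2, y. repeat split; auto. econstructor; [exact Hys|].
    apply (bf_fun HB k HG2 (Forall2_mono _ Hs2 Hxy) Hy). assumption.
Qed.

Lemma sat_atomic_forth k ts G :
  Forall (tbound n) ts -> B G -> matching G n v0 v1 e0 e1 ->
  sat S0 v0 e0 (fatom k ts) -> sat S1 v1 e1 (fatom k ts).
Proof.
  intros Hb HG Hm (xs & Hxs & Hk).
  destruct (term_list_forth (Forall_impl _ teval_forth Hb) HG Hm Hxs) as (G' & ys & HG' & _ & Hxy & Hys).
  exists ys. split; [assumption|]. apply (bf_rel HB k HG' Hxy). assumption.
Qed.

Lemma sat_eq_forth t u G :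
  tbound n t -> tbound n u -> B G -> matching G n v0 v1 e0 e1 ->
  sat S0 v0 e0 (feq t u) -> sat S1 v1 e1 (feq t u).
Proof.
  intros Ht Hu HG Hm (x & Hx & Hx').
  destruct (teval_forth Ht HG Hm Hx) as (G1 & y & HG1 & Hs1 & Hxy & Hy).
  destruct (teval_forth Hu HG1 (matching_mono _ Hs1 Hm) Hx') as (G2 & z & HG2 & Hs2 & Hxz & Hz).
  exists y. split; [assumption|].
  rewrite (proj1 (bf_eq HB HG2 (Hs2 _ _ Hxy) Hxz) eq_refl). assumption.
Qed.

End Forth.

(** Members of [B] extend to members of [B], with no rank to be used up, so the induction passes
    through any number of quantifiers. [G] and [n] stay general because each quantifier enlarges the
    map and adds a variable. *)
Theorem back_and_forth_sat X0 X1 P (S0 : structure X0) (S1 : structure X1) B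
  (HB : back_and_forth S0 S1 B) (v0 : P -> X0) (v1 : P -> X1) phi {n G} e0 e1 :
  fbound n phi -> B G -> matching G n v0 v1 e0 e1 ->
  (sat S0 v0 e0 phi <-> sat S1 v1 e1 phi).
Proof.
  pose proof (back_and_forth_flip HB) as HB'.
  revert n G e0 e1. induction phi as [k ts|t u|g IH|g IHg h IHh|g IH]; intros n G e0 e1 Hb HG Hm.
  - split; intros H.
    + exact (sat_atomic_forth HB Hb HG Hm H).
    + exact (sat_atomic_forth HB' (G := fun b a => G a b) Hb HG (matching_flip Hm) H).
  - destruct Hb as [Ht Hu]. split; intros H.
    + exact (sat_eq_forth HB Ht Hu HG Hm H).
    + exact (sat_eq_forth HB' (G := fun b a => G a b) Ht Hu HG (matching_flip Hm) H).
  - simpl. rewrite (IH n G e0 e1); [reflexivity|assumption..].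
  - destruct Hb as [Hg Hh]. simpl.
    rewrite (IHg n G e0 e1), (IHh n G e0 e1); [reflexivity|assumption..].
  - simpl. split; intros H.
    + intros b Hd. destruct (bf_back HB b HG Hd) as (G' & a & HG' & Hs & Hab).
      apply (IH (S n) G' (scons a e0) (scons b e1)); trivial.
      * apply matching_scons; [|assumption]. exact (matching_mono _ Hs Hm).
      * apply H. apply (bf_dom HB HG' Hab).
    + intros a Hd. destruct (bf_forth HB a HG Hd) as (G' & b & HG' & Hs & Hab).
      apply (IH (S n) G' (scons a e0) (scons b e1)); trivial.
      * apply matching_scons; [|assumption]. exact (matching_mono _ Hs Hm).
      * apply H. apply (bf_dom HB HG' Hab).
Qed.

Lemma back_and_forth_extend X0 X1 (S0 : structure X0) (S1 : structure X1) B
  (HB : back_and_forth S0 S1 B) (e0 : nat -> X0) (He : forall i, sdom S0 (e0 i)) n {G} :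
  B G -> exists G' e1, B G' /\ (forall a b, G a b -> G' a b) /\
    (forall i, sdom S1 (e1 i)) /\ (forall i, i < n -> G' (e0 i) (e1 i)).
Proof.
  revert G. induction n as [|n IH]; intros G HG.
  (* No variable has to be matched yet; the forth step only supplies an element of [S1] as the
     default value of [e1]. *)
  - destruct (bf_forth HB (e0 0) HG (He 0)) as (G' & b & HG' & Hs & Hb).
    exists G', (fun _ => b). repeat split; auto; [|lia].
    intros _. apply (bf_dom HB HG' Hb).
  - destruct (IH G HG) as (G1 & e1 & HG1 & Hs1 & Hd1 & He1).
    destruct (bf_forth HB (e0 n) HG1 (He n)) as (G2 & b & HG2 & Hs2 & Hb).
    exists G2, (fun i => if Nat.eq_dec i n then b else e1 i). repeat split; auto.
    + intros i. destruct (Nat.eq_dec i n); [|auto]. apply (bf_dom HB HG2 Hb).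
    + intros i Hi. destruct (Nat.eq_dec i n) as [->|]; [assumption|].
      apply Hs2, He1. lia.
Qed.

(** * Renaming parameters *)

(** Formulas over two parameter sets have different Rocq types, so carrying a type across a
    bijection of parameters requires an explicit renaming. *)
Fixpoint tmap {P Q : Type} (g : P -> Q) (t : term P) : term Q :=
  match t with
  | tvar i => tvar i
  | tpar p => tpar (g p)
  | tfun k ts => tfun k (map (tmap g) ts)
  end.

Fixpoint fmap {P Q : Type} (g : P -> Q) (phi : form P) : form Q :=
  match phi with
  | fatom k ts => fatom k (map (tmap g) ts)
  | feq t u => feq (tmap g t) (tmap g u)
  | fneg h => fneg (fmap g h)
  | fimp h h' => fimp (fmap g h) (fmap g h')
  | fall h => fall (fmap g h)
  end.

Lemma tmap_inv P Q (g : P -> Q) (g' : Q -> P) (H : forall p, g' (g p) = p) t :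
  tmap g' (tmap g t) = t.
Proof.
  induction t as [i|p|k ts IH] using term_nested_ind; simpl; [reflexivity|congruence|].
  f_equal. rewrite map_map. induction IH; simpl; congruence.
Qed.

Lemma fmap_inv P Q (g : P -> Q) (g' : Q -> P) (H : forall p, g' (g p) = p) phi :
  fmap g' (fmap g phi) = phi.
Proof.
  induction phi as [k ts|t u|h IH|h IH h' IH'|h IH]; simpl; try congruence.
  - f_equal. rewrite map_map. rewrite <- map_id. apply map_ext. apply tmap_inv, H.
  - rewrite !tmap_inv; auto.
Qed.

Lemma tmap_bound P Q (g : P -> Q) n t : tbound n t -> tbound n (tmap g t).
Proof.
  induction t as [i|p|k ts IH] using term_nested_ind; intros Hb; inversion Hb; subst;
    constructor; trivial.
  apply Forall_map. rewrite Forall_forall in *. auto.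
Qed.

Lemma fmap_bound P Q (g : P -> Q) phi : forall n, fbound n phi -> fbound n (fmap g phi).
Proof.
  induction phi as [k ts|t u|h IH|h IH h' IH'|h IH]; simpl; intros n Hb; auto.
  - apply Forall_map. eapply Forall_impl; [|exact Hb]. intros; apply tmap_bound; assumption.
  - destruct Hb. split; apply tmap_bound; assumption.
  - destruct Hb. auto.
Qed.

Lemma teval_tmap P Q X (S : structure X) (g : P -> Q) v e t : forall x,
  teval S v e (tmap g t) x <-> teval S (fun p => v (g p)) e t x.
Proof.
  induction t as [i|p|k ts IH] using term_nested_ind; intros x; simpl.
  - split; intros H; inversion H; constructor.
  - split; intros H; inversion H; subst.
    + apply (te_par S (fun p => v (g p)) e p).
    + apply te_par.
  - assert (Hl : forall xs, Forall2 (teval S v e) (map (tmap g) ts) xs <->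
      Forall2 (teval S (fun p => v (g p)) e) ts xs).
    { induction IH as [|t ts Ht _ IH']; intros xs; split; intros H; inversion H; subst;
        constructor; try apply Ht; try apply IH'; assumption. }
    split; intros H; inversion H; subst; econstructor; try eassumption; apply Hl; assumption.
Qed.

Lemma Forall2_teval_tmap P Q X (S : structure X) (g : P -> Q) v e ts : forall xs,
  Forall2 (teval S v e) (map (tmap g) ts) xs <-> Forall2 (teval S (fun p => v (g p)) e) ts xs.
Proof.
  induction ts as [|t ts IH]; intros xs; split; intros H; inversion H; subst;
    constructor; try apply IH; try assumption; apply (teval_tmap S g v e t); assumption.
Qed.

Lemma sat_fmap P Q X (S : structure X) (g : P -> Q) v phi : forall e,
  sat S v e (fmap g phi) <-> sat S (fun p => v (g p)) e phi.
Proof.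
  induction phi as [k ts|t u|h IH|h IH h' IH'|h IH]; simpl; intros e.
  - split; intros (xs & H & H'); exists xs; (split; [|assumption]);
      apply (Forall2_teval_tmap S g v e ts); assumption.
  - split; intros (x & H & H'); exists x; split; apply (teval_tmap S g v e); assumption.
  - rewrite IH. reflexivity.
  - rewrite IH, IH'. reflexivity.
  - split; intros H x Hx; apply IH; auto.
Qed.

(** * Ehrenfeucht-Fraïssé games of finite length *)

Section Game.
Variables (X0 X1 : Type) (S0 : structure X0) (S1 : structure X1) (N : nat).

(** The bound [N] on the symbols makes a position describable by finitely many atomic formulas.
    Tuples [ps] may repeat pairs of [l], so every arity is covered. *)
Definition position_ok (l : list (X0 * X1)) : Prop :=
  (forall q, In q l -> sdom S0 (fst q) /\ sdom S1 (snd q)) /\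
  (forall q r, In q l -> In r l -> (fst q = fst r <-> snd q = snd r)) /\
  (forall k ps, k < N -> incl ps l ->
     (srel S0 k (map fst ps) <-> srel S1 k (map snd ps))) /\
  (forall k ps q, k < N -> incl ps l -> In q l ->
     (sfun S0 k (map fst ps) (fst q) <-> sfun S1 k (map snd ps) (snd q))).

Fixpoint wins (i : nat) (l : list (X0 * X1)) : Prop :=
  position_ok l /\
  match i with
  | 0 => True
  | S i => (forall a, sdom S0 a -> exists b, sdom S1 b /\ wins i ((a, b) :: l)) /\
           (forall b, sdom S1 b -> exists a, sdom S0 a /\ wins i ((a, b) :: l))
  end.

End Game.

(** * Hintikka formulas and winning strategies *)

Definition ex_form {P} (phi : form P) : form P := fneg (fall (fneg phi)).
Definition and_form {P} (phi psi : form P) : form P := fneg (fimp phi (fneg psi)).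
Definition top_form {P} : form P := fall (feq (tvar 0) (tvar 0)).

Lemma sat_ex_form X P (S : structure X) (v : P -> X) e phi :
  sat S v e (ex_form phi) <-> exists x, sdom S x /\ sat S v (scons x e) phi.
Proof.
  simpl. split.
  - intros H. apply NNPP. intros H'. apply H. intros x Hx Hs. eauto.
  - intros (x & Hx & Hs) H. exact (H x Hx Hs).
Qed.

Lemma sat_and_form X P (S : structure X) (v : P -> X) e phi psi :
  sat S v e (and_form phi psi) <-> sat S v e phi /\ sat S v e psi.
Proof. simpl. tauto. Qed.

Lemma sat_top_form X P (S : structure X) (v : P -> X) e : sat S v e top_form.
Proof. simpl. intros x _. exists x. split; apply (te_var S v (scons x e) 0). Qed.

(** Each member decides every formula of [Th], and every assignment satisfies some member. The
    closed formula [top_form] is the empty conjunction. *)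
Fixpoint diagrams {P} (Th : list (form P)) : list (form P) :=
  match Th with
  | [] => [top_form]
  | t :: Th => flat_map (fun d => [and_form t d; and_form (fneg t) d]) (diagrams Th)
  end.

Lemma diagram_exists X P (S : structure X) (v : P -> X) e Th :
  exists d, In d (diagrams Th) /\ sat S v e d.
Proof.
  induction Th as [|t Th (d & Hd & Hs)].
  - exists top_form. split; [left; reflexivity|apply sat_top_form].
  - destruct (classic (sat S v e t)) as [H|H].
    + exists (and_form t d). split; [apply in_flat_map; exists d; simpl; auto|].
      apply sat_and_form. auto.
    + exists (and_form (fneg t) d). split; [apply in_flat_map; exists d; simpl; auto|].
      apply sat_and_form. auto.
Qed.

Lemma diagram_agree {X0 X1 P} {S0 : structure X0} {S1 : structure X1} {v0 : P -> X0}
  {v1 : P -> X1} {e0 e1 Th d} : In d (diagrams Th) -> sat S0 v0 e0 d -> sat S1 v1 e1 d ->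
  forall t, In t Th -> (sat S0 v0 e0 t <-> sat S1 v1 e1 t).
Proof.
  revert d. induction Th as [|u Th IH]; intros d Hd H0 H1 t []; subst;
    apply in_flat_map in Hd; destruct Hd as (d' & Hd' & [<-|[<-|[]]]);
    rewrite sat_and_form in H0, H1; destruct H0 as [H0 H0'], H1 as [H1 H1'].
  - tauto.
  - simpl in H0, H1. tauto.
  - eauto.
  - eauto.
Qed.

Lemma diagram_bound P n (Th : list (form P)) : (forall t, In t Th -> fbound n t) ->
  forall d, In d (diagrams Th) -> fbound n d.
Proof.
  induction Th as [|u Th IH]; intros H d Hd.
  - destruct Hd as [<-|[]]. simpl. split; constructor; lia.
  - apply in_flat_map in Hd. destruct Hd as (d' & Hd' & Hd).
    assert (Hu : fbound n u) by (apply H; left; reflexivity).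
    assert (Hd'' : fbound n d') by (apply IH; [intros; apply H; right|]; assumption).
    destruct Hd as [<-|[<-|[]]]; simpl; auto.
Qed.

Fixpoint indices (m r : nat) : list (list nat) :=
  match r with
  | 0 => [[]]
  | S r => flat_map (fun i => map (cons i) (indices m r)) (seq 0 m)
  end.

Lemma in_indices m r : forall l, In l (indices m r) <-> length l = r /\ Forall (fun i => i < m) l.
Proof.
  induction r as [|r IH]; intros l; simpl.
  - split; [intros [<-|[]]; auto|]. intros [H _]. destruct l; [auto|discriminate].
  - rewrite in_flat_map. split.
    + intros (i & Hi & Hl). apply in_seq in Hi. apply in_map_iff in Hl.
      destruct Hl as (l' & <- & Hl). apply IH in Hl. destruct Hl as [<- Hl].
      split; [reflexivity|]. constructor; [lia|assumption].
    + intros [H Hl]. destruct Hl as [|i l Hi Hl]; [discriminate|]. exists i.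
      split; [apply in_seq; lia|]. apply in_map, IH. auto.
Qed.

(** Unnested atoms suffice, because [position_ok] compares the graphs of functions rather than
    values of terms. *)
Definition symbol_atoms (L : lang) (m k : nat) : list sentence :=
  match L k with
  | None => []
  | Some (false, r) => map (fun l => fatom k (map tvar l)) (indices m r)
  | Some (true, r) => flat_map (fun l => map (fun i => feq (tfun k (map tvar l)) (tvar i)) (seq 0 m))
      (indices m r)
  end.

Definition atoms (L : lang) (N m : nat) : list sentence :=
  flat_map (fun i => map (fun i' => feq (tvar i) (tvar i')) (seq 0 m)) (seq 0 m) ++
  flat_map (symbol_atoms L m) (seq 0 N).

(** Existential formulas serve both players' sides of a round: agreement is an equivalence, so a
    diagram realized in either structure is realized in the other. *)
Fixpoint game_formulas (L : lang) (N i m : nat) : list sentence :=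
  atoms L N m ++
  match i with
  | 0 => []
  | S i => map ex_form (diagrams (game_formulas L N i (S m)))
  end.

Lemma bound_vars P m l : Forall (fun i => i < m) l -> Forall (@tbound P m) (map tvar l).
Proof. induction 1; constructor; [constructor|]; assumption. Qed.

Lemma atoms_bound L N m t : In t (atoms L N m) -> fbound m t.
Proof.
  unfold atoms. rewrite in_app_iff, !in_flat_map. intros [(i & Hi & H)|(k & _ & H)].
  - apply in_map_iff in H. destruct H as (i' & <- & Hi'). apply in_seq in Hi, Hi'.
    split; constructor; lia.
  - unfold symbol_atoms in H. destruct (L k) as [[[|] r]|].
    + apply in_flat_map in H. destruct H as (l & Hl & H). apply in_map_iff in H.
      destruct H as (i & <- & Hi). apply in_seq in Hi. apply in_indices in Hl.
      split; constructor; [|lia]. apply bound_vars, Hl.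
    + apply in_map_iff in H. destruct H as (l & <- & Hl). apply in_indices in Hl.
      apply bound_vars, Hl.
    + destruct H.
Qed.

Lemma game_formulas_bound L N i : forall m t, In t (game_formulas L N i m) -> fbound m t.
Proof.
  induction i as [|i IH]; intros m t; simpl; rewrite in_app_iff; intros [H|H];
    try (eapply atoms_bound; eassumption).
  - destruct H.
  - apply in_map_iff in H. destruct H as (d & <- & Hd). simpl.
    eapply diagram_bound; [|exact Hd]. apply IH.
Qed.

(** Index 0 is the head of the list, that is the latest move of the game, matching the variable
    bound by an outer [ex_form]. *)
Definition extend {X} (l : list X) (e : nat -> X) : nat -> X := fold_right scons e l.

Lemma in_index X0 X1 (l : list (X0 * X1)) e0 e1 q : In q l -> exists i, i < length l /\
  extend (map fst l) e0 i = fst q /\ extend (map snd l) e1 i = snd q.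
Proof.
  induction l as [|r l IH]; [intros []|]. intros [<-|H].
  - exists 0. simpl. split; [lia|auto].
  - destruct (IH H) as (i & Hi & H0 & H1). exists (S i). simpl. split; [lia|auto].
Qed.

Lemma in_indices_list X0 X1 (l : list (X0 * X1)) e0 e1 ps : incl ps l ->
  exists is, length is = length ps /\ Forall (fun i => i < length l) is /\
  map (extend (map fst l) e0) is = map fst ps /\ map (extend (map snd l) e1) is = map snd ps.
Proof.
  induction ps as [|q ps IH]; intros H.
  - exists []. auto.
  - apply incl_cons_inv in H. destruct H as [Hq H].
    destruct (in_index l e0 e1 q Hq) as (i & Hi & H0 & H1).
    destruct (IH H) as (is & Hlen & His & Hs0 & Hs1).
    exists (i :: is). simpl. repeat split; auto; congruence.
Qed.

Lemma teval_vars X P (S : structure X) (v : P -> X) e is : forall xs,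
  Forall2 (teval S v e) (map tvar is) xs <-> xs = map e is.
Proof.
  induction is as [|i is IH]; intros xs; simpl; split; intros H.
  - inversion H. reflexivity.
  - subst. constructor.
  - inversion H as [|? ? ? ? Hi His]; subst. inversion Hi; subst. f_equal. apply IH, His.
  - subst. constructor; [constructor|]. apply IH. reflexivity.
Qed.

Lemma sat_relation_vars X P (S : structure X) (v : P -> X) e k is :
  sat S v e (fatom k (map tvar is)) <-> srel S k (map e is).
Proof.
  simpl. split.
  - intros (xs & H & Hk). apply teval_vars in H. subst. assumption.
  - intros H. eexists. split; [|exact H]. apply teval_vars. reflexivity.
Qed.

Lemma sat_function_vars X P (S : structure X) (v : P -> X) e k is i :
  sat S v e (feq (tfun k (map tvar is)) (tvar i)) <-> sfun S k (map e is) (e i).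
Proof.
  simpl. split.
  - intros (x & H & Hk). inversion Hk; subst. inversion H as [| |? ? xs ? H1 H2]; subst.
    apply teval_vars in H1. subst. assumption.
  - intros H. exists (e i). split; [|constructor]. econstructor; [|exact H].
    apply teval_vars. reflexivity.
Qed.

Lemma sat_eq_vars X P (S : structure X) (v : P -> X) e i i' :
  sat S v e (feq (tvar i) (tvar i')) <-> e i = e i'.
Proof.
  simpl. split.
  - intros (x & H & Hk). inversion H; inversion Hk; congruence.
  - intros H. exists (e i). split; [constructor|rewrite H; constructor].
Qed.

Section Hintikka.
Variables (X0 X1 : Type) (S0 : structure X0) (S1 : structure X1) (L : lang) (N : nat).
Hypothesis W0 : wf_structure L S0.
Hypothesis W1 : wf_structure L S1.

Lemma agree_position_ok (l : list (X0 * X1)) e0 e1 :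
  (forall q, In q l -> sdom S0 (fst q) /\ sdom S1 (snd q)) ->
  (forall t, In t (atoms L N (length l)) ->
    (sat S0 noparam (extend (map fst l) e0) t <-> sat S1 noparam (extend (map snd l) e1) t)) ->
  position_ok S0 S1 N l.
Proof.
  intros Hd H. split; [assumption|]. split; [|split].
  - intros q r Hq Hr.
    destruct (in_index l e0 e1 q Hq) as (i & Hi & <- & <-).
    destruct (in_index l e0 e1 r Hr) as (i' & Hi' & <- & <-).
    rewrite <- (sat_eq_vars S0 noparam), <- (sat_eq_vars S1 noparam). apply H.
    apply in_app_iff. left. apply in_flat_map. exists i. split; [apply in_seq; lia|].
    apply in_map_iff. exists i'. split; [reflexivity|apply in_seq; lia].
  - intros k ps Hk Hps. destruct (in_indices_list e0 e1 Hps) as (is & Hl & His & H0 & H1).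
    (* There is an atom only for a symbol of [L] used with its own arity. Whichever side satisfies
       the relation supplies this information through [wf_structure]. *)
    assert (G : forall r, L k = Some (false, r) -> length ps = r ->
      (srel S0 k (map fst ps) <-> srel S1 k (map snd ps))).
    { intros r Hr Hlen. rewrite <- H0, <- H1.
      rewrite <- (sat_relation_vars S0 noparam), <- (sat_relation_vars S1 noparam). apply H.
      apply in_app_iff. right. apply in_flat_map. exists k. split; [apply in_seq; lia|].
      unfold symbol_atoms. rewrite Hr. apply in_map_iff. exists is. split; [reflexivity|].
      apply in_indices. split; [congruence|assumption]. }
    split; intros Hs.
    + destruct W0 as (_ & Wr & _). destruct (Wr _ _ Hs) as (r & Hr & Hlen & _).
      rewrite length_map in Hlen. apply (G r); assumption.
    + destruct W1 as (_ & Wr & _). destruct (Wr _ _ Hs) as (r & Hr & Hlen & _).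
      rewrite length_map in Hlen. apply (G r); assumption.
  - intros k ps q Hk Hps Hq. destruct (in_indices_list e0 e1 Hps) as (is & Hl & His & H0 & H1).
    destruct (in_index l e0 e1 q Hq) as (i & Hi & Hi0 & Hi1).
    assert (G : forall r, L k = Some (true, r) -> length ps = r ->
      (sfun S0 k (map fst ps) (fst q) <-> sfun S1 k (map snd ps) (snd q))).
    { intros r Hr Hlen. rewrite <- H0, <- H1, <- Hi0, <- Hi1.
      rewrite <- (sat_function_vars S0 noparam), <- (sat_function_vars S1 noparam). apply H.
      apply in_app_iff. right. apply in_flat_map. exists k. split; [apply in_seq; lia|].
      unfold symbol_atoms. rewrite Hr. apply in_flat_map. exists is. split.
      - apply in_indices. split; [congruence|assumption].
      - apply in_map_iff. exists i. split; [reflexivity|apply in_seq; lia]. }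
    split; intros Hs.
    + destruct W0 as (_ & _ & Wf & _). destruct (Wf _ _ _ Hs) as (r & Hr & Hlen & _).
      rewrite length_map in Hlen. apply (G r); assumption.
    + destruct W1 as (_ & _ & Wf & _). destruct (Wf _ _ _ Hs) as (r & Hr & Hlen & _).
      rewrite length_map in Hlen. apply (G r); assumption.
Qed.

(** The reply to a move is read off its diagram [d]: [ex_form d] is one of the formulas agreed upon,
    so it holds in the other structure, and any witness leaves a position that agrees on the
    formulas for [i] rounds. *)
Lemma agree_wins i : forall (l : list (X0 * X1)) e0 e1,
  (forall q, In q l -> sdom S0 (fst q) /\ sdom S1 (snd q)) ->
  (forall t, In t (game_formulas L N i (length l)) ->
    (sat S0 noparam (extend (map fst l) e0) t <-> sat S1 noparam (extend (map snd l) e1) t)) ->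
  wins S0 S1 N i l.
Proof.
  induction i as [|i IH]; intros l e0 e1 Hd H; simpl in H; simpl.
  - split; [|exact I]. apply (agree_position_ok l e0 e1 Hd). intros t Ht. apply H.
    apply in_app_iff. auto.
  - split; [|split].
    + apply (agree_position_ok l e0 e1 Hd). intros t Ht. apply H. apply in_app_iff. auto.
    + intros a Ha. destruct (diagram_exists S0 noparam (scons a (extend (map fst l) e0))
        (game_formulas L N i (S (length l)))) as (d & Hd' & Hs).
      assert (G : sat S1 noparam (extend (map snd l) e1) (ex_form d)).
      { apply H; [|apply sat_ex_form; eauto]. apply in_app_iff. right. apply in_map, Hd'. }
      apply sat_ex_form in G. destruct G as (b & Hb & Hs'). exists b. split; [assumption|].
      apply (IH ((a, b) :: l) e0 e1).
      * intros q [<-|Hq]; auto.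
      * simpl. apply (diagram_agree Hd' Hs Hs').
    + intros b Hb. destruct (diagram_exists S1 noparam (scons b (extend (map snd l) e1))
        (game_formulas L N i (S (length l)))) as (d & Hd' & Hs).
      assert (G : sat S0 noparam (extend (map fst l) e0) (ex_form d)).
      { apply H; [|apply sat_ex_form; eauto]. apply in_app_iff. right. apply in_map, Hd'. }
      apply sat_ex_form in G. destruct G as (a & Ha & Hs'). exists a. split; [assumption|].
      apply (IH ((a, b) :: l) e0 e1).
      * intros q [<-|Hq]; auto.
      * simpl. apply (diagram_agree Hd' Hs' Hs).
Qed.

End Hintikka.

Fixpoint ex_forms {P} (m : nat) (phi : form P) : form P :=
  match m with 0 => phi | S m => ex_forms m (ex_form phi) end.

Lemma ex_forms_bound P m : forall (phi : form P) n, fbound (m + n) phi -> fbound n (ex_forms m phi).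
Proof. induction m; intros phi n H; simpl; [assumption|]. apply IHm. exact H. Qed.

Lemma sat_ex_forms X P (S : structure X) (v : P -> X) e m : forall phi,
  sat S v e (ex_forms m phi) <->
  exists xs, length xs = m /\ Forall (sdom S) xs /\ sat S v (extend xs e) phi.
Proof.
  induction m as [|m IH]; intros phi; simpl.
  - split.
    + intros H. exists []. auto.
    + intros ([|] & H & _ & Hs); [assumption|discriminate].
  - rewrite IH. split.
    + intros (xs & Hl & Hx & H). apply sat_ex_form in H. destruct H as (x & Hd & Hs).
      exists (x :: xs). simpl. auto.
    + intros ([|x xs] & Hl & Hx & H); [discriminate|]. inversion Hx; subst.
      exists xs. split; [simpl in Hl; lia|]. split; [assumption|]. apply sat_ex_form. eauto.
Qed.

Lemma complete_theory_equiv L T (HT : complete_theory L T) X (S0 S1 : structure X) :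
  wf_structure L S0 -> wf_structure L S1 -> models S0 T -> models S1 T ->
  forall phi e, fbound 0 phi -> sat S1 noparam e phi -> sat S0 noparam e phi.
Proof.
  intros W0 W1 HS0 HS1 phi e Hb H. destruct HT as [_ HT]. destruct (HT phi Hb) as [G|G].
  - apply G; assumption.
  - destruct (G X S1 W1 HS1 e H).
Qed.

(** The existential closure of the diagram of [ys] is a sentence true in [S1], hence in [S0] by
    completeness, and its witnesses become the partners of [ys]. Starting from prescribed [ys] is
    what later makes a map cover a given finite set. *)
Theorem wins_exists L T (HT : complete_theory L T) X (S0 S1 : structure X) N i :
  wf_structure L S0 -> wf_structure L S1 -> models S0 T -> models S1 T ->
  forall ys, Forall (sdom S1) ys -> exists l, map snd l = ys /\ wins S0 S1 N i l.
Proof.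
  intros W0 W1 HS0 HS1 ys Hys. destruct (proj1 W0) as [d0 Hd0].
  pose (e := fun _ : nat => d0).
  destruct (diagram_exists S1 noparam (extend ys e) (game_formulas L N i (length ys)))
    as (d & Hd & Hs).
  assert (G : sat S0 noparam e (ex_forms (length ys) d)).
  { apply (complete_theory_equiv HT W0 W1 HS0 HS1).
    - apply ex_forms_bound. rewrite Nat.add_0_r.
      eapply diagram_bound; [|exact Hd]. apply game_formulas_bound.
    - apply sat_ex_forms. eauto. }
  apply sat_ex_forms in G. destruct G as (xs & Hl & Hx & Hs').
  assert (C : map fst (combine xs ys) = xs /\ map snd (combine xs ys) = ys).
  { clear - Hl. revert ys Hl. induction xs as [|x xs IH]; intros [|y ys] Hl; try discriminate; auto.
    injection Hl as Hl. destruct (IH ys Hl). simpl. split; f_equal; assumption. }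
  destruct C as [C0 C1]. exists (combine xs ys). split; [assumption|].
  apply (agree_wins N W0 W1 i (combine xs ys) e e).
  - intros [x y] Hq. rewrite Forall_forall in Hx, Hys. simpl. split.
    + apply Hx. eapply in_combine_l, Hq.
    + apply Hys. eapply in_combine_r, Hq.
  - rewrite C0, C1, length_combine, Hl, Nat.min_id. exact (diagram_agree Hd Hs' Hs).
Qed.

(** * Structures inside a model of set theory *)

(** Unlike [srel] of [decode], this mentions neither lists nor [L], so it is first-order over [R]
    and can occur in a transferred formula. The symbol [x] may be a nonstandard number. *)
Definition rel_holds {X} (R : X -> X -> Prop) (I x c : X) : Prop :=
  exists y, rel_in R I x y /\ R c y.

Definition fun_holds {X} (R : X -> X -> Prop) (I x c b : X) : Prop :=
  exists y, rel_in R I x y /\ rel_in R y c b.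

(* [d] is 0 for relation symbols and 1 for function symbols, as in [lang_in]. *)
Definition symbol_kind {X} (R : X -> X -> Prop) (d : nat) (s x : X) : Prop :=
  exists p q xd xn, R p s /\ opair R p x q /\ opair R q xd xn /\ is_num R xd d.

(** The body of [lang_in] with its witness named, since [s] becomes a parameter of the transferred
    formula. *)
Definition codes_lang {X} (R : X -> X -> Prop) (L : lang) (s : X) : Prop :=
  forall z, R z s <->
    exists k kd n x q xd xn, L k = Some (kd, n) /\ is_num R x k /\
      is_num R xd (if kd : bool then 1 else 0) /\ is_num R xn n /\
      opair R q xd xn /\ opair R z x q.

Section Decode.
Variables (X : Type) (R : X -> X -> Prop).
Hypothesis HZ : ZFCminus R.
Variable L : lang.

Lemma symbol_kind_iff s x d : codes_lang R L s ->
  (symbol_kind R d s x <->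
   exists k kd n, L k = Some (kd, n) /\ is_num R x k /\ d = if kd : bool then 1 else 0).
Proof.
  intros Hs. split.
  - intros (p & q & xd & xn & Hp & Hpq & Hq & Hd). apply Hs in Hp.
    destruct Hp as (k & kd & n & x' & q' & xd' & xn' & Hk & Hx & Hd' & _ & Hq' & Hp').
    destruct (opair_inj HZ Hpq Hp'); subst. destruct (opair_inj HZ Hq Hq'); subst.
    exists k, kd, n. split; [assumption|]. split; [assumption|]. exact (num_inj HZ Hd Hd').
  - intros (k & kd & n & Hk & Hx & ->).
    destruct (num_exists HZ (if kd then 1 else 0)) as [xd Hd].
    destruct (num_exists HZ n) as [xn Hn].
    destruct (opair_exists HZ xd xn) as [q Hq]. destruct (opair_exists HZ x q) as [p Hp].
    exists p, q, xd, xn. split; [|auto]. apply Hs. exists k, kd, n, x, q, xd, xn. auto 7.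
Qed.

Variables (m u I : X).
Hypothesis Hm : opair R m u I.

Lemma sdom_decode a : sdom (decode R L m) a <-> R a u.
Proof.
  simpl. split.
  - intros (u' & I' & Hm' & Ha). destruct (opair_inj HZ Hm Hm'); subst. assumption.
  - eauto.
Qed.

Lemma interp_iff k y : interp R L m k y <-> exists x, is_num R x k /\ rel_in R I x y.
Proof.
  split.
  - intros (u' & I' & x & Hm' & Hx & Hy). destruct (opair_inj HZ Hm Hm'); subst. eauto.
  - intros (x & Hx & Hy). exists u, I, x. auto.
Qed.

Lemma srel_decode {k n x c xs} : L k = Some (false, n) -> length xs = n -> is_num R x k ->
  tuple_code R c xs -> (srel (decode R L m) k xs <-> rel_holds R I x c).
Proof.
  intros Hk Hn Hx Hc. simpl. split.
  - intros (n' & y & c' & _ & _ & Hy & Hc' & Hcy). apply interp_iff in Hy.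
    destruct Hy as (x' & Hx' & Hy). rewrite (num_unique HZ Hx Hx').
    rewrite (tuple_code_unique HZ Hc Hc'). exists y. auto.
  - intros (y & Hy & Hcy). exists n, y, c. rewrite interp_iff. eauto 8.
Qed.

Lemma sfun_decode {k n x c xs b} : L k = Some (true, n) -> length xs = n -> is_num R x k ->
  tuple_code R c xs -> (sfun (decode R L m) k xs b <-> fun_holds R I x c b).
Proof.
  intros Hk Hn Hx Hc. simpl. split.
  - intros (n' & y & c' & _ & _ & Hy & Hc' & Hcy). apply interp_iff in Hy.
    destruct Hy as (x' & Hx' & Hy). rewrite (num_unique HZ Hx Hx').
    rewrite (tuple_code_unique HZ Hc Hc'). exists y. auto.
  - intros (y & Hy & Hcy). exists n, y, c. rewrite interp_iff. eauto 8.
Qed.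

Hypothesis HL : is_Lstructure R L m.

Lemma interp_spec k kd n x y : L k = Some (kd, n) -> is_num R x k -> rel_in R I x y ->
  if kd : bool then fun_interp R u n y else rel_interp R u n y.
Proof.
  intros Hk Hx Hy. destruct HL as (_ & u' & I' & Hm' & _ & _ & Hf & Ht).
  destruct (opair_inj HZ Hm Hm'); subst u' I'.
  destruct (Ht k kd n Hk) as (x' & y' & Hx' & Hy' & H).
  rewrite (num_unique HZ Hx' Hx) in Hy'. rewrite (Hf k x y y' Hx Hy Hy'). assumption.
Qed.

Lemma rel_holds_spec {k n x c} : L k = Some (false, n) -> is_num R x k -> rel_holds R I x c ->
  exists xs, length xs = n /\ Forall (fun a => R a u) xs /\ tuple_code R c xs.
Proof.
  intros Hk Hx (y & Hy & Hc). exact (interp_spec Hk Hx Hy c Hc).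
Qed.

Lemma fun_holds_spec {k n x c b} : L k = Some (true, n) -> is_num R x k -> fun_holds R I x c b ->
  R b u /\ exists xs, length xs = n /\ Forall (fun a => R a u) xs /\ tuple_code R c xs.
Proof.
  intros Hk Hx (y & Hy & p & Hp & Hp'). destruct (interp_spec Hk Hx Hy) as (H & _).
  destruct (H p Hp) as (c' & b' & xs & Hpc & Hc & Hn & Hxs & Hb).
  destruct (opair_inj HZ Hp' Hpc); subst. eauto.
Qed.

Lemma decode_wf : wf_structure L (decode R L m).
Proof.
  destruct HL as (_ & u' & I' & Hm' & [a Ha] & _ & Hf & Ht).
  destruct (opair_inj HZ Hm Hm'); subst u' I'.
  split; [exists a; apply sdom_decode, Ha|].
  assert (Hdom : forall xs, Forall (fun a => R a u) xs -> Forall (sdom (decode R L m)) xs).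
  { intros xs. apply Forall_impl. intros; apply sdom_decode; assumption. }
  split; [|split; [|split]].
  - intros k xs (n & y & c & Hk & Hn & Hy & Hc & Hcy). exists n. split; [assumption|].
    split; [assumption|]. apply interp_iff in Hy. destruct Hy as (x & Hx & Hy).
    destruct (@rel_holds_spec k n x c Hk Hx) as (xs' & _ & Hd & Hc'); [exists y; auto|].
    rewrite (tuple_code_inj HZ Hc Hc'). auto.
  - intros k xs b (n & y & c & Hk & Hn & Hy & Hc & Hcy). exists n. split; [assumption|].
    split; [assumption|]. apply interp_iff in Hy. destruct Hy as (x & Hx & Hy).
    destruct (@fun_holds_spec k n x c b Hk Hx) as (Hb & xs' & _ & Hd & Hc'); [exists y; auto|].
    rewrite (tuple_code_inj HZ Hc Hc'). rewrite sdom_decode. auto.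
  - intros k n xs Hk Hn Hxs. destruct (Ht k true n Hk) as (x & y & Hx & Hy & _ & H & _).
    destruct (H xs) as (c & b & Hc & Hb); [assumption|eapply Forall_impl; [|exact Hxs];
      intros; apply sdom_decode; assumption|].
    exists b. apply (sfun_decode Hk Hn Hx Hc). exists y. auto.
  - intros k xs b b' H H'. pose proof H as (n & _ & c & Hk & Hn & _ & Hc & _).
    destruct (num_exists HZ k) as [x Hx].
    apply (sfun_decode Hk Hn Hx Hc) in H. apply (sfun_decode Hk Hn Hx Hc) in H'.
    destruct H as (y & Hy & H), H' as (y' & Hy' & H').
    rewrite <- (Hf k x y y' Hx Hy Hy') in H'.
    destruct (interp_spec Hk Hx Hy) as (_ & _ & G). exact (G c b b' H H').
Qed.

End Decode.

(** The counterpart of [Forall2 G] on codes: it is first-order when [G] is given by a set, and it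
    makes sense for tuples of nonstandard length. *)
Definition corresponds {X} (R : X -> X -> Prop) (G : X -> X -> Prop) (c c' : X) : Prop :=
  (forall p, R p c -> exists i a b p', opair R p i a /\ G a b /\ opair R p' i b /\ R p' c') /\
  (forall p', R p' c' -> exists i a b p, opair R p' i b /\ G a b /\ opair R p i a /\ R p c).

Lemma corresponds_flip X (R : X -> X -> Prop) G c c' :
  corresponds R G c c' -> corresponds R (fun b a => G a b) c' c.
Proof.
  intros [H H']. split; intros p Hp.
  - destruct (H' p Hp) as (i & a & b & q & ?). exists i, b, a, q. tauto.
  - destruct (H p Hp) as (i & a & b & q & ?). exists i, b, a, q. tauto.
Qed.

Lemma Forall2_nth A B (G : A -> B -> Prop) xs ys : Forall2 G xs ys -> forall i,
  match nth_error xs i, nth_error ys i with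
  | Some a, Some b => G a b
  | None, None => True
  | _, _ => False
  end.
Proof. induction 1; intros [|i]; simpl; auto. apply IHForall2. Qed.

Lemma Forall2_corresponds X (R : X -> X -> Prop) (HZ : ZFCminus R) (G : X -> X -> Prop) xs ys c c' :
  Forall2 G xs ys -> tuple_code R c xs -> tuple_code R c' ys -> corresponds R G c c'.
Proof.
  intros H Hc Hc'. split; intros p Hp.
  - apply Hc in Hp. destruct Hp as (i & a & x & Hi & Hx & Hp).
    pose proof (Forall2_nth H i) as Hn. rewrite Hi in Hn.
    destruct (nth_error ys i) as [b|] eqn:Hb; [|destruct Hn].
    destruct (opair_exists HZ x b) as [q Hq]. exists x, a, b, q. repeat (split; [assumption|]).
    apply Hc'. eauto 6.
  - apply Hc' in Hp. destruct Hp as (i & b & x & Hi & Hx & Hp).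
    pose proof (Forall2_nth H i) as Hn. rewrite Hi in Hn.
    destruct (nth_error xs i) as [a|] eqn:Ha; [|destruct Hn].
    destruct (opair_exists HZ x a) as [q Hq]. exists x, a, b, q. repeat (split; [assumption|]).
    apply Hc. eauto 6.
Qed.

(** Since [G] is functional, [c'] can have only one entry at each position of [c]; hence [c'] is
    again the code of a list. *)
Lemma corresponds_code X (R : X -> X -> Prop) (HZ : ZFCminus R) (G : X -> X -> Prop) xs c c'
  (HG : forall a b b', G a b -> G a b' -> b = b') :
  tuple_code R c xs -> corresponds R G c c' -> exists ys, Forall2 G xs ys /\ tuple_code R c' ys.
Proof.
  intros Hc [H H'].
  assert (Hx : forall a, In a xs -> exists b, G a b).
  { intros a Ha. apply In_nth_error in Ha. destruct Ha as [i Hi].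
    destruct (num_exists HZ i) as [x Hx]. destruct (opair_exists HZ x a) as [p Hp].
    destruct (H p) as (x' & a' & b & _ & Hp' & Hab & _); [apply Hc; eauto 6|].
    destruct (opair_inj HZ Hp Hp'); subst. eauto. }
  assert (Hys : exists ys, Forall2 G xs ys).
  { clear - Hx. induction xs as [|a xs IH]; [exists []; auto|].
    destruct (Hx a) as [b Hb]; [left; reflexivity|].
    destruct IH as [ys Hys]; [intros; apply Hx; right; assumption|].
    exists (b :: ys). auto. }
  destruct Hys as [ys Hys]. exists ys. split; [assumption|]. intros p. split.
  - intros Hp. destruct (H' p Hp) as (x & a & b & q & Hpb & Hab & Hq & Hqc).
    apply Hc in Hqc. destruct Hqc as (i & a' & x' & Hi & Hx' & Hq').
    destruct (opair_inj HZ Hq Hq'); subst a' x'.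
    pose proof (Forall2_nth Hys i) as Hn. rewrite Hi in Hn.
    destruct (nth_error ys i) as [b'|] eqn:Hb'; [|destruct Hn].
    rewrite (HG _ _ _ Hn Hab) in Hb'. eauto 6.
  - intros (i & b & x & Hi & Hx' & Hp).
    pose proof (Forall2_nth Hys i) as Hn. rewrite Hi in Hn.
    destruct (nth_error xs i) as [a|] eqn:Ha; [|destruct Hn].
    destruct (opair_exists HZ x a) as [q Hq].
    destruct (H q) as (x' & a' & b' & p' & Hq' & Hab & Hp' & Hpc); [apply Hc; eauto 6|].
    destruct (opair_inj HZ Hq Hq'); subst a' x'.
    rewrite (HG _ _ _ Hab Hn) in Hp'. rewrite (opair_unique HZ Hp Hp'). assumption.
Qed.

(** * Internal systems of partial isomorphisms *)

(** Nothing requires [c] and [c'] to code tuples, as this would need external lists. In a structure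
    satisfying [is_Lstructure], whatever an interpretation of a symbol holds of is a tuple
    anyway. *)
Definition partial_iso {X} (R : X -> X -> Prop) (s u0 I0 u1 I1 n f : X) : Prop :=
  (forall a b, rel_in R f a b -> R a u0 /\ R b u1) /\
  (forall a b a' b', rel_in R f a b -> rel_in R f a' b' -> (a = a' <-> b = b')) /\
  (forall x c c', R x n -> corresponds R (rel_in R f) c c' ->
    (symbol_kind R 0 s x -> (rel_holds R I0 x c <-> rel_holds R I1 x c')) /\
    (symbol_kind R 1 s x -> forall b b', rel_in R f b b' ->
       (fun_holds R I0 x c b <-> fun_holds R I1 x c' b'))).

Definition extends_into {X} (R : X -> X -> Prop) (u0 u1 I x f : X) : Prop :=
  (forall a, R a u0 -> exists b f', R b u1 /\ rel_in R I x f' /\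
     (forall a' b', rel_in R f a' b' -> rel_in R f' a' b') /\ rel_in R f' a b) /\
  (forall b, R b u1 -> exists a f', R a u0 /\ rel_in R I x f' /\
     (forall a' b', rel_in R f a' b' -> rel_in R f' a' b') /\ rel_in R f' a b).

(* [J] consists of pairs of a level and a partial map; maps of level [x + 1]
   extend to maps of level [x]. *)
Definition iso_system {X} (R : X -> X -> Prop) (s u0 I0 u1 I1 n J : X) : Prop :=
  forall y f, rel_in R J y f -> partial_iso R s u0 I0 u1 I1 n f /\
    forall x, is_succ R x y -> extends_into R u0 u1 J x f.

(** The number [n] bounds the symbols preserved and is also the level of [f], so one nonstandard
    choice of [n] removes both bounds. The set [h0] will witness that the pulled-back parameters are
    pseudofinite. *)
Definition finitely_approximable {X} (R : X -> X -> Prop) (s u0 I0 u1 I1 : X) : Prop :=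
  forall w n h, is_omega R w -> R n w -> ifinite R h ->
  exists J f h0, iso_system R s u0 I0 u1 I1 n J /\ rel_in R J n f /\
    (forall b, R b h -> R b u1 -> exists a, rel_in R f a b) /\
    ifinite R h0 /\ (forall a b, rel_in R f a b -> R a h0).

Ltac unfold_sets := unfold finitely_approximable, iso_system, extends_into, partial_iso,
  corresponds, symbol_kind, rel_holds, fun_holds, ifinite, is_omega, inductive_set, is_num,
  rel_in, opair, upair, is_succ, is_empty.

Lemma definable_partial_iso i0 i1 i2 i3 i4 i5 i6 : definable (fun X R e =>
  partial_iso R (e i0) (e i1) (e i2) (e i3) (e i4) (e i5) (e i6)).
Proof. unfold_sets. definability. Qed.

Lemma definable_extends_into i0 i1 i2 i3 i4 : definable (fun X R e =>
  extends_into R (e i0) (e i1) (e i2) (e i3) (e i4)).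
Proof. unfold_sets. definability. Qed.

Lemma definable_finitely_approximable i0 i1 i2 i3 i4 : definable (fun X R e =>
  finitely_approximable R (e i0) (e i1) (e i2) (e i3) (e i4)).
Proof. unfold_sets. definability. Qed.

(** * Finite sets in a well-founded model *)

Section Finite.
Variables (X : Type) (R : X -> X -> Prop).
Hypothesis HZ : ZFCminus R.
Variable w : X.
Hypothesis Hw : is_omega R w.

(** Well-foundedness makes the descent through predecessors stop at the empty set after finitely
    many steps. *)
Lemma wf_omega_standard (Hwf : well_founded R) {x} : R x w -> exists k, is_num R x k.
Proof.
  induction x as [x IH] using (well_founded_induction Hwf). intros Hx.
  destruct (omega_cases HZ Hw Hx) as [H|(y & Hy & Hs)]; [exists 0; exact H|].
  destruct (IH y) as [k Hk]; [apply Hs; auto|assumption|]. exists (S k). exists y. auto.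
Qed.

Lemma ifinite_empty h : is_empty R h -> ifinite R h.
Proof.
  intros Hh. destruct Hw as [[(e & He & He') _] _].
  exists w, e, e. split; [exact Hw|]. split; [exact He|]. repeat split.
  - intros i Hi. destruct (He' i Hi).
  - intros i a a' Hi. destruct (He' i Hi).
  - intros i i' a Hi. destruct (He' i Hi).
  - intros a Ha. destruct (Hh a Ha).
Qed.

Lemma ifinite_adjoin h h' a : ifinite R h -> (forall z, R z h' <-> R z h \/ z = a) -> ifinite R h'.
Proof.
  intros Hh Hh'. destruct (classic (R a h)) as [Ha|Ha].
  { replace h' with h; [assumption|]. apply (set_ext HZ). intros z. rewrite Hh'.
    split; [auto|]. intros [|]; subst; auto. }
  destruct Hh as (w' & n & f & Hw' & Hn & H1 & H2 & H3 & H4).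
  assert (Hs : exists s, R s w' /\ is_succ R n s) by (apply Hw'; assumption).
  destruct Hs as (s & Hs & Hns).
  (* [ifinite] constrains [f] only on arguments in [n]. Restricting it to [n] removes any value it
     may already have at [n], before the new pair is added there. *)
  destruct (@separation X R HZ (fun X R e => exists i b, opair R (e 0) i b /\ R i (e 1)))
    with (e := env n [n]) (x := f) as [f0 Hf0]. { unfold opair, upair. definability. }
  simpl in Hf0. destruct (opair_exists HZ n a) as [p Hp].
  destruct (adjoin_exists HZ f0 p) as [g Hg].
  assert (Hrel : forall i b, rel_in R g i b <-> (R i n /\ rel_in R f i b) \/ (i = n /\ b = a)).
  { intros i b. split.
    - intros (q & Hq & Hq'). apply Hg in Hq. destruct Hq as [Hq| ->].
      + apply Hf0 in Hq. destruct Hq as (Hq & i' & b' & Hq'' & Hi).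
        destruct (opair_inj HZ Hq' Hq''); subst. left. split; [assumption|]. exists q. auto.
      + destruct (opair_inj HZ Hq' Hp). auto.
    - intros [[Hi (q & Hq & Hq')]|[-> ->]].
      + exists q. split; [|assumption]. apply Hg. left. apply Hf0. eauto 6.
      + exists p. split; [|assumption]. apply Hg. auto. }
  assert (Hrange : forall i b, R i n -> rel_in R f i b -> R b h).
  { intros i b Hi Hb. destruct (H1 i Hi) as (b' & Hb' & Hib). rewrite (H2 i b b'); assumption. }
  exists w', s, g. split; [assumption|]. split; [assumption|]. split; [|split; [|split]].
  - intros i Hi. apply Hns in Hi. destruct Hi as [Hi| ->].
    + destruct (H1 i Hi) as (b & Hb & Hib). exists b. rewrite Hh', Hrel. auto.
    + exists a. rewrite Hh', Hrel. auto.
  - intros i b b' _. rewrite !Hrel. intros [[Hi Hb]|[-> ->]] [[Hi' Hb']|[E' ->]]; subst.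
    + eauto.
    + destruct (not_mem_self HZ Hi).
    + destruct (not_mem_self HZ Hi').
    + reflexivity.
  - intros i i' b _ _. rewrite !Hrel. intros [[Hi Hb]|[-> ->]] [[Hi' Hb']|[-> E']]; subst.
    + eauto.
    + destruct Ha. eauto.
    + destruct Ha. eauto.
    + reflexivity.
  - intros b Hb. apply Hh' in Hb. destruct Hb as [Hb| ->].
    + destruct (H4 b Hb) as (i & Hi & Hib). exists i. rewrite Hrel. split; [apply Hns|]; auto.
    + exists n. rewrite Hrel. split; [apply Hns|]; auto.
Qed.

Lemma list_ifinite l : forall h, (forall z, R z h <-> In z l) -> ifinite R h.
Proof.
  induction l as [|a l IH]; intros h Hh.
  - apply ifinite_empty. intros z Hz. apply Hh in Hz. exact Hz.
  - destruct (list_set_exists HZ l) as [h0 Hh0].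
    apply (@ifinite_adjoin h0 h a); [apply IH; assumption|]. intros z. rewrite Hh, Hh0. simpl.
    split; intros [?|?]; auto.
Qed.

End Finite.

Lemma wf_ifinite_list X (R : X -> X -> Prop) (HZ : ZFCminus R) (Hwf : well_founded R) h :
  ifinite R h -> exists l, forall a, R a h -> In a l.
Proof.
  intros (w & n & f & Hw & Hn & _ & H2 & _ & H4).
  destruct (wf_omega_standard HZ Hw Hwf Hn) as [k Hk].
  assert (G : forall j, j <= k -> exists l, forall i x a, i < j -> is_num R x i ->
    rel_in R f x a -> In a l).
  { induction j as [|j IH]; intros Hj; [exists []; intros; lia|].
    destruct IH as [l Hl]; [lia|]. destruct (num_exists HZ j) as [x Hx].
    destruct (classic (exists a, rel_in R f x a)) as [[a Ha]|Hno].
    - exists (a :: l). intros i y b Hi Hy Hb. destruct (Nat.eq_dec i j) as [->|].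
      + left. rewrite (num_unique HZ Hy Hx) in Hb. apply (H2 x); trivial.
        apply (mem_num HZ _ Hk). eauto.
      + right. apply (Hl i y); [lia|assumption..].
    - exists l. intros i y b Hi Hy Hb. destruct (Nat.eq_dec i j) as [->|].
      + destruct Hno. rewrite (num_unique HZ Hy Hx) in Hb. eauto.
      + apply (Hl i y); [lia|assumption..]. }
  destruct (G k) as [l Hl]; [lia|]. exists l. intros a Ha.
  destruct (H4 a Ha) as (x & Hx & Hxa). apply (mem_num HZ _ Hk) in Hx.
  destruct Hx as (i & Hi & Hx). eauto.
Qed.

(** * Finite partial maps coded by lists *)

Definition codes_map {X} (R : X -> X -> Prop) (f : X) (l : list (X * X)) : Prop :=
  forall p, R p f <-> exists a b, In (a, b) l /\ opair R p a b.

Section Maps.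
Variables (X : Type) (R : X -> X -> Prop).
Hypothesis HZ : ZFCminus R.

Lemma codes_map_rel f l a b : codes_map R f l -> (rel_in R f a b <-> In (a, b) l).
Proof.
  intros Hf. split.
  - intros (p & Hp & Hp'). apply Hf in Hp. destruct Hp as (a' & b' & Hin & Hp).
    destruct (opair_inj HZ Hp Hp'); subst. assumption.
  - intros Hin. destruct (opair_exists HZ a b) as [p Hp]. exists p. split; [|assumption].
    apply Hf. eauto.
Qed.

Lemma codes_map_adjoin f g p a b l : codes_map R g l -> opair R p a b ->
  (codes_map R f ((a, b) :: l) <-> forall z, R z f <-> R z g \/ z = p).
Proof.
  intros Hg Hp.
  assert (H : forall z, (exists c d, In (c, d) ((a, b) :: l) /\ opair R z c d) <-> R z g \/ z = p).
  { intros z. rewrite (Hg z). split.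
    - intros (c & d & [[= <- <-]|Hin] & Hz); [right|left; eauto]. exact (opair_unique HZ Hz Hp).
    - intros [(c & d & Hin & Hz)| ->]; [exists c, d|exists a, b]; simpl; auto. }
  split; intros Hf z; rewrite (Hf z), (H z); reflexivity.
Qed.

Lemma codes_map_exists l : exists f, codes_map R f l.
Proof.
  induction l as [|[a b] l [g Hg]].
  - destruct (empty_exists HZ) as [g Hg]. exists g. intros z. split.
    + intros Hz. destruct (Hg z Hz).
    + intros (? & ? & [] & _).
  - destruct (opair_exists HZ a b) as [p Hp]. destruct (adjoin_exists HZ g p) as [f Hf].
    exists f. exact (proj2 (codes_map_adjoin f Hg Hp) Hf).
Qed.

Lemma opairs_superset x y : exists D, forall a b p, R a x -> R b y -> opair R p a b -> R p D.
Proof.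
  destruct (@collection2 X R HZ (fun X R v a b => opair R v a b)) with (x := x) (y := y) as [D HD].
  - unfold opair, upair. intros. definability.
  - intros a b _ _. apply (opair_exists HZ).
  - exists D. intros a b p Ha Hb Hp. destruct (HD a b Ha Hb) as (q & Hq & Hq').
    rewrite (opair_unique HZ Hp Hq'). assumption.
Qed.

(** Stands in for the powerset of a product. A map of size [m + 1] is a map of size [m] with one
    pair adjoined, so collection over maps and pairs bounds the next size. *)
Lemma maps_superset u0 u1 m : exists P, forall l f, length l = m ->
  (forall q, In q l -> R (fst q) u0 /\ R (snd q) u1) -> codes_map R f l -> R f P.
Proof.
  induction m as [|m [P HP]].
  - destruct (empty_exists HZ) as [e He]. destruct (list_set_exists HZ [e]) as [P HP].
    exists P. intros [|] f Hl _ Hf; [|discriminate]. apply HP. left. apply (set_ext HZ).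
    intros z. split; [intros Hz; destruct (He z Hz)|]. intros Hz. apply Hf in Hz.
    destruct Hz as (? & ? & [] & _).
  - destruct (opairs_superset u0 u1) as [D HD].
    destruct (@collection2 X R HZ (fun X R v a b => forall z, R z v <-> R z a \/ z = b))
      with (x := P) (y := D) as [Q HQ].
    + intros. definability.
    + intros a b _ _. apply (adjoin_exists HZ).
    + exists Q. intros [|[a b] l] f Hl Hd Hf; [discriminate|].
      destruct (codes_map_exists l) as [g Hg]. destruct (opair_exists HZ a b) as [p Hp].
      pose proof (proj1 (codes_map_adjoin f Hg Hp) Hf) as Hf'.
      destruct (HQ g p) as (f1 & Hf1 & Hf1').
      * apply (HP l); [simpl in Hl; lia| |assumption]. intros q Hq. apply Hd. right. assumption.
      * destruct (Hd (a, b)) as [Ha Hb]; [left; reflexivity|]. exact (HD a b p Ha Hb Hp).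
      * replace f with f1; [assumption|]. apply (set_ext HZ). intros z. rewrite Hf', Hf1'.
        reflexivity.
Qed.

End Maps.

(** * Winning positions yield internal systems *)

Section Internal.
Variables (X : Type) (R : X -> X -> Prop).
Hypothesis HZ : ZFCminus R.
Variables (L : lang) (s m0 u0 I0 m1 u1 I1 : X).
Hypothesis Hs : codes_lang R L s.
Hypothesis Hm0 : opair R m0 u0 I0.
Hypothesis Hm1 : opair R m1 u1 I1.
Hypothesis HL0 : is_Lstructure R L m0.
Hypothesis HL1 : is_Lstructure R L m1.
Variables (N : nat) (n : X).
Hypothesis Hn : is_num R n N.

Let S0 := decode R L m0.
Let S1 := decode R L m1.

Lemma Forall2_in_list (l : list (X * X)) xs ys :
  Forall2 (fun a b => In (a, b) l) xs ys ->
  exists ps, incl ps l /\ map fst ps = xs /\ map snd ps = ys.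
Proof.
  induction 1 as [|a b xs ys Hab _ (ps & Hps & <- & <-)].
  - exists []. split; [intros q []|auto].
  - exists ((a, b) :: ps). split; [apply incl_cons; assumption|auto].
Qed.

(** A relation or function that holds at an internal code [c] forces [c] to code a genuine list; the
    correspondence then turns [c] and [c'] into a list of pairs from [l], to which [position_ok]
    applies. *)
Lemma position_partial_iso l f : position_ok S0 S1 N l -> codes_map R f l ->
  partial_iso R s u0 I0 u1 I1 n f.
Proof.
  intros (Hd & He & Hr & Hf) Hc.
  assert (Hrel : forall a b, rel_in R f a b <-> In (a, b) l)
    by (intros; apply (codes_map_rel HZ); assumption).
  assert (Heq : forall a b a' b', rel_in R f a b -> rel_in R f a' b' -> (a = a' <-> b = b')).
  { intros a b a' b' H H'. apply Hrel in H, H'. exact (He _ _ H H'). }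
  split; [|split; [exact Heq|]].
  - intros a b H. apply Hrel in H. destruct (Hd _ H) as [Ha Hb].
    apply (sdom_decode HZ L Hm0) in Ha. apply (sdom_decode HZ L Hm1) in Hb. auto.
  - intros x c c' Hx Hcc'. apply (mem_num HZ _ Hn) in Hx. destruct Hx as (k & Hk & Hx).
    assert (Hps : forall xs, tuple_code R c xs -> exists ps, incl ps l /\ map fst ps = xs /\
      tuple_code R c' (map snd ps)).
    { intros xs Hxs. destruct (@corresponds_code X R HZ (rel_in R f) xs c c') as (ys & H & Hys).
      - intros a b b' Hb Hb'. apply (Heq a b a b'); trivial.
      - assumption.
      - assumption.
      - destruct (@Forall2_in_list l xs ys) as (ps & Hps & <- & <-); [|eauto].
        eapply Forall2_mono; [|exact H]. intros a b. apply Hrel. }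
    assert (Hps' : forall ys, tuple_code R c' ys -> exists ps, incl ps l /\ map snd ps = ys /\
      tuple_code R c (map fst ps)).
    { intros ys Hys. destruct (@corresponds_code X R HZ (fun b a => rel_in R f a b) ys c' c)
        as (xs & H & Hxs).
      - intros b a a' Ha Ha'. apply (Heq a b a' b); trivial.
      - assumption.
      - apply corresponds_flip. assumption.
      - destruct (@Forall2_in_list l xs ys) as (ps & Hps1 & <- & <-); [|eauto].
        eapply Forall2_mono; [|exact (Forall2_flip H)]. intros a b. apply Hrel. }
    split; intros Hk'; apply (symbol_kind_iff HZ _ _ Hs) in Hk';
      destruct Hk' as (k' & kd & r & HLk & Hx' & Hkd);
      rewrite (num_inj HZ Hx' Hx) in HLk; destruct kd; try discriminate.
    + split; intros H.
      * destruct (rel_holds_spec HZ Hm0 HL0 HLk Hx H) as (xs & Hlen & _ & Hxs).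
        destruct (Hps xs Hxs) as (ps & Hps1 & <- & Hys). rewrite length_map in Hlen.
        apply (srel_decode HZ L Hm1 HLk (eq_trans (length_map _ _) Hlen) Hx Hys).
        apply Hr; [assumption..|].
        apply (srel_decode HZ L Hm0 HLk (eq_trans (length_map _ _) Hlen) Hx Hxs). assumption.
      * destruct (rel_holds_spec HZ Hm1 HL1 HLk Hx H) as (ys & Hlen & _ & Hys).
        destruct (Hps' ys Hys) as (ps & Hps1 & <- & Hxs). rewrite length_map in Hlen.
        apply (srel_decode HZ L Hm0 HLk (eq_trans (length_map _ _) Hlen) Hx Hxs).
        apply Hr; [assumption..|].
        apply (srel_decode HZ L Hm1 HLk (eq_trans (length_map _ _) Hlen) Hx Hys). assumption.
    + intros b b' Hb. apply Hrel in Hb. split; intros H.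
      * destruct (fun_holds_spec HZ Hm0 HL0 HLk Hx H) as (_ & xs & Hlen & _ & Hxs).
        destruct (Hps xs Hxs) as (ps & Hps1 & <- & Hys). rewrite length_map in Hlen.
        apply (sfun_decode HZ L Hm1 HLk (eq_trans (length_map _ _) Hlen) Hx Hys).
        apply (Hf k ps (b, b')); [assumption..|].
        apply (sfun_decode HZ L Hm0 HLk (eq_trans (length_map _ _) Hlen) Hx Hxs). assumption.
      * destruct (fun_holds_spec HZ Hm1 HL1 HLk Hx H) as (_ & ys & Hlen & _ & Hys).
        destruct (Hps' ys Hys) as (ps & Hps1 & <- & Hxs). rewrite length_map in Hlen.
        apply (sfun_decode HZ L Hm0 HLk (eq_trans (length_map _ _) Hlen) Hx Hxs).
        apply (Hf k ps (b, b')); [assumption..|].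
        apply (sfun_decode HZ L Hm1 HLk (eq_trans (length_map _ _) Hlen) Hx Hys). assumption.
Qed.

Lemma wins_position i l : wins S0 S1 N i l -> position_ok S0 S1 N l.
Proof. destruct i; apply proj1. Qed.

Lemma opairs_with x P : exists Z, forall f p, R f P -> opair R p x f -> R p Z.
Proof.
  destruct (list_set_exists HZ [x]) as [x' Hx']. destruct (opairs_superset HZ x' P) as [D HD].
  exists D. intros f p Hf Hp. apply (HD x f p); [|assumption..]. apply Hx'. left. reflexivity.
Qed.

Lemma wins_maps i l : wins S0 S1 N i l -> forall q, In q l -> R (fst q) u0 /\ R (snd q) u1.
Proof.
  intros H q Hq. apply wins_position in H. destruct (proj1 H q Hq) as [Ha Hb].
  apply (sdom_decode HZ L Hm0) in Ha. apply (sdom_decode HZ L Hm1) in Hb. auto.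
Qed.

(** [wins] is an external notion, so separation cannot select winning positions. It selects instead
    the partial isomorphisms that extend into the system already built, and every winning position
    is among them. The size [m] is general because replies at level [i] have size [m + 1]. *)
Lemma wins_iso_system i : forall m, exists J, iso_system R s u0 I0 u1 I1 n J /\
  forall l f x, length l = m -> wins S0 S1 N i l -> codes_map R f l -> is_num R x i ->
    rel_in R J x f.
Proof.
  induction i as [|i IH]; intros m; destruct (maps_superset HZ u0 u1 m) as [P HP].
  - destruct (num_exists HZ 0) as [x Hx]. destruct (opairs_with x P) as [Z HZP].
    destruct (@separation X R HZ (fun X R e => exists f, opair R (e 0) (e 1) f /\
      partial_iso R (e 2) (e 3) (e 4) (e 5) (e 6) (e 7) f))
      with (e := env x [x; s; u0; I0; u1; I1; n]) (x := Z) as [J HJ].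
    { pose proof definable_partial_iso. unfold opair, upair. definability. }
    simpl in HJ. exists J. split.
    + intros y f (p & Hp & Hyf). apply HJ in Hp. destruct Hp as (_ & f' & Hf' & Hiso).
      destruct (opair_inj HZ Hyf Hf'); subst y f'. split; [assumption|].
      (* Level 0 is empty as a set, hence not a successor, so no extension is demanded. *)
      intros y Hy. destruct (Hx y). apply Hy. auto.
    + intros l f y Hl Hwin Hf Hy. rewrite (@num_unique X R HZ 0 y x Hy Hx).
      destruct (opair_exists HZ x f) as [p Hp]. exists p. split; [|assumption].
      apply HJ. split.
      * apply (HZP f); [|assumption]. apply (HP l f); trivial. exact (wins_maps _ _ Hwin).
      * exists f. split; [assumption|]. exact (position_partial_iso (wins_position _ _ Hwin) Hf).
  - destruct (IH (S m)) as (J' & HJ' & Hwins'). destruct (num_exists HZ i) as [x Hx].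
    destruct (succ_exists HZ x) as [y Hy]. destruct (opairs_with y P) as [Z HZP].
    destruct (@separation X R HZ (fun X R e => exists f, opair R (e 0) (e 1) f /\
      partial_iso R (e 2) (e 3) (e 4) (e 5) (e 6) (e 7) f /\
      extends_into R (e 3) (e 5) (e 8) (e 9) f))
      with (e := env y [y; s; u0; I0; u1; I1; n; J'; x]) (x := Z) as [J0 HJ0].
    { pose proof definable_partial_iso. pose proof definable_extends_into.
      unfold opair, upair. definability. }
    simpl in HJ0. destruct (binary_union HZ J' J0) as [J HJ].
    assert (Hincl : forall z f, rel_in R J' z f -> rel_in R J z f).
    { intros z f (p & Hp & Hzf). exists p. split; [|assumption]. apply HJ. auto. }
    assert (Hmono : forall z f, extends_into R u0 u1 J' z f -> extends_into R u0 u1 J z f).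
    { intros z f [H0 H1]. split.
      - intros a Ha. destruct (H0 a Ha) as (b & f' & Hb & Hf' & H). eauto 6.
      - intros b Hb. destruct (H1 b Hb) as (a & f' & Ha & Hf' & H). eauto 6. }
    exists J. split.
    + intros z f (p & Hp & Hzf). apply HJ in Hp. destruct Hp as [Hp|Hp].
      * destruct (HJ' z f) as [Hiso Hext]; [exists p; auto|]. split; [assumption|].
        intros z' Hz'. apply Hmono, Hext, Hz'.
      * apply HJ0 in Hp. destruct Hp as (_ & f' & Hf' & Hiso & Hext).
        destruct (opair_inj HZ Hzf Hf'); subst z f'. split; [assumption|].
        (* The predecessor of the new level is unique, so extension into level [x] is all that is
           required, and it persists when [J'] grows to [J]. *)
        intros z' Hz'. rewrite (succ_inj HZ Hz' Hy). apply Hmono, Hext.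
    + intros l f z Hl Hwin Hf Hz.
      rewrite (num_unique HZ Hz (num_succ Hx Hy)).
      destruct (opair_exists HZ y f) as [p Hp]. exists p. split; [|assumption].
      apply HJ. right. apply HJ0. split.
      { apply (HZP f); [|assumption]. apply (HP l f); trivial. exact (wins_maps _ _ Hwin). }
      exists f. split; [assumption|].
      split; [exact (position_partial_iso (wins_position _ _ Hwin) Hf)|].
      destruct Hwin as (_ & Hforth & Hback).
      assert (Hext : forall a b, wins S0 S1 N i ((a, b) :: l) -> exists f', rel_in R J' x f' /\
        (forall a' b', rel_in R f a' b' -> rel_in R f' a' b') /\ rel_in R f' a b).
      { intros a b Hab. destruct (codes_map_exists HZ ((a, b) :: l)) as [f' Hf'].
        exists f'. split; [|split].
        - apply (Hwins' ((a, b) :: l)); trivial. simpl. congruence.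
        - intros a' b' H. apply (codes_map_rel HZ _ _ Hf) in H.
          apply (codes_map_rel HZ _ _ Hf'). right. assumption.
        - apply (codes_map_rel HZ _ _ Hf'). left. reflexivity. }
      split.
      * intros a Ha. apply (sdom_decode HZ L Hm0) in Ha.
        destruct (Hforth a Ha) as (b & Hb & Hab). apply (sdom_decode HZ L Hm1) in Hb.
        destruct (Hext a b Hab) as (f' & ?). eauto.
      * intros b Hb. apply (sdom_decode HZ L Hm1) in Hb.
        destruct (Hback b Hb) as (a & Ha & Hab). apply (sdom_decode HZ L Hm0) in Ha.
        destruct (Hext a b Hab) as (f' & ?). eauto.
Qed.

End Internal.

Theorem wf_finitely_approximable X (R : X -> X -> Prop) (HZ : ZFCminus R)
  (Hwf : well_founded R) L T (HT : complete_theory L T) s m0 u0 I0 m1 u1 I1 :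
  codes_lang R L s -> opair R m0 u0 I0 -> opair R m1 u1 I1 ->
  is_Lstructure R L m0 -> is_Lstructure R L m1 ->
  models (decode R L m0) T -> models (decode R L m1) T ->
  finitely_approximable R s u0 I0 u1 I1.
Proof.
  intros Hs Hm0 Hm1 HL0 HL1 HT0 HT1 w n h Hw Hn Hh.
  destruct (wf_omega_standard HZ Hw Hwf Hn) as [N HN].
  destruct (wf_ifinite_list HZ Hwf Hh) as [lh Hlh].
  (* [h] may have members outside the universe [u1]; only those inside it can be played in the
     game. *)
  assert (Hys : exists ys, Forall (sdom (decode R L m1)) ys /\
    forall b, In b lh -> R b u1 -> In b ys).
  { clear Hlh. induction lh as [|b lh (ys & Hys & H)].
    - exists []. split; [constructor|intros b []].
    - destruct (classic (R b u1)) as [Hb|Hb].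
      + exists (b :: ys). split.
        * constructor; [apply (sdom_decode HZ L Hm1), Hb|assumption].
        * intros c [<-|Hc] Hcu; simpl; auto.
      + exists ys. split; [assumption|]. intros c [<-|Hc] Hcu; [contradiction|auto]. }
  destruct Hys as (ys & Hys & Hin).
  (* The same [N] bounds the symbols and counts the rounds, as [n] does in
     [finitely_approximable]. *)
  destruct (wins_exists HT N N (decode_wf HZ Hm0 HL0) (decode_wf HZ Hm1 HL1) HT0 HT1 Hys)
    as (l & Hl & Hwin).
  destruct (wins_iso_system HZ Hs Hm0 Hm1 HL0 HL1 N n HN N (length l)) as (J & HJ & HJl).
  destruct (codes_map_exists HZ l) as [f Hf].
  destruct (list_set_exists HZ (map fst l)) as [h0 Hh0].
  exists J, f, h0. split; [assumption|]. split; [eapply HJl; eauto|]. split; [|split].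
  - intros b Hb Hbu. assert (H : In b (map snd l)) by (rewrite Hl; auto).
    apply in_map_iff in H. destruct H as ([a b'] & E & H). simpl in E. subst b'. exists a.
    apply (codes_map_rel HZ _ _ Hf). assumption.
  - exact (list_ifinite HZ Hw _ _ Hh0).
  - intros a b H. apply (codes_map_rel HZ _ _ Hf) in H. apply Hh0.
    apply in_map_iff. exists (a, b). auto.
Qed.

(** * Nonstandard levels *)

Section Nonstandard.
Variables (X : Type) (R : X -> X -> Prop).
Hypothesis HZ : ZFCminus R.
Variables (L : lang) (s m0 u0 I0 m1 u1 I1 : X).
Hypothesis Hm0 : opair R m0 u0 I0.
Hypothesis Hm1 : opair R m1 u1 I1.
(** These hypotheses replace [is_Lstructure], which fails for the image of a structure when [L] is
    infinite: its interpretation function is then defined at nonstandard symbols too. Each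
    hypothesis concerns one standard symbol, so it can be transferred. *)
Hypothesis Hsym : forall k (kd : bool) r x, L k = Some (kd, r) -> is_num R x k ->
  symbol_kind R (if kd then 1 else 0) s x.
Hypothesis Hcod0 : forall k r x c b, L k = Some (true, r) -> is_num R x k ->
  fun_holds R I0 x c b -> R b u0.
Hypothesis Hcod1 : forall k r x c b, L k = Some (true, r) -> is_num R x k ->
  fun_holds R I1 x c b -> R b u1.

Let S0 := decode R L m0.
Let S1 := decode R L m1.

(** Being nonstandard is not definable in the target model, so this system exists only outside it.
    This is harmless, because [back_and_forth] is an external notion. *)
Definition nonstandard_map (w J : X) (G : X -> X -> Prop) : Prop :=
  exists x f, R x w /\ (forall k, ~ is_num R x k) /\ rel_in R J x f /\
    forall a b, G a b <-> rel_in R f a b.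

(* Nonstandard levels are closed under predecessors and every standard symbol lies
   below [n], so no bound on the quantifier rank or on the language remains. *)
Lemma nonstandard_back_and_forth w n J : is_omega R w -> R n w -> (forall k, ~ is_num R n k) ->
  iso_system R s u0 I0 u1 I1 n J -> back_and_forth S0 S1 (nonstandard_map w J).
Proof.
  intros Hw Hn Hns HJ.
  assert (Hcod : forall m u I, opair R m u I ->
    (forall k r x c b, L k = Some (true, r) -> is_num R x k -> fun_holds R I x c b -> R b u) ->
    forall k xs b, sfun (decode R L m) k xs b -> sdom (decode R L m) b).
  { intros m u I Hm Hc k xs b H. pose proof H as (r & _ & c & Hk & Hr & _ & Hxs & _).
    destruct (num_exists HZ k) as [x Hx]. apply (sfun_decode HZ L Hm Hk Hr Hx Hxs) in H.
    apply (sdom_decode HZ L Hm). exact (Hc k r x c b Hk Hx H). }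
  assert (Hext : forall x f, R x w -> (forall k, ~ is_num R x k) -> rel_in R J x f ->
    exists y, R y w /\ (forall k, ~ is_num R y k) /\ extends_into R u0 u1 J y f).
  { intros x f Hx Hxs Hf. destruct (nonstandard_pred HZ Hw Hx Hxs) as (y & Hy & Hys & Hyx).
    exists y. split; [assumption|]. split; [assumption|]. apply (HJ x f Hf), Hyx. }
  split.
  - intros G a b (x & f & _ & _ & Hf & HG) Hab. apply HG in Hab.
    destruct (HJ x f Hf) as [[Hd _] _]. destruct (Hd a b Hab).
    split; [apply (sdom_decode HZ L Hm0)|apply (sdom_decode HZ L Hm1)]; assumption.
  - intros G a b a' b' (x & f & _ & _ & Hf & HG) Hab Hab'. apply HG in Hab, Hab'.
    destruct (HJ x f Hf) as [(_ & He & _) _]. exact (He a b a' b' Hab Hab').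
  - intros G k xs ys (x & f & _ & _ & Hf & HG) Hxy.
    assert (H : forall r, L k = Some (false, r) -> length xs = r ->
      (srel S0 k xs <-> srel S1 k ys)).
    { intros r Hk Hr. assert (Hr' : length ys = r) by (rewrite <- (Forall2_length Hxy); assumption).
      destruct (num_exists HZ k) as [z Hz]. destruct (tuple_code_exists HZ xs) as [c Hc].
      destruct (tuple_code_exists HZ ys) as [c' Hc'].
      unfold S0, S1.
      rewrite (srel_decode HZ L Hm0 Hk Hr Hz Hc), (srel_decode HZ L Hm1 Hk Hr' Hz Hc').
      destruct (HJ x f Hf) as [(_ & _ & Hi) _]. apply (Hi z c c').
      - exact (num_in_nonstandard HZ Hw Hz Hn Hns).
      - apply (@Forall2_corresponds X R HZ _ xs ys); [|assumption..].
        eapply Forall2_mono; [|exact Hxy]. intros a b. apply HG.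
      - exact (Hsym _ Hk Hz). }
    split; intros Hs.
    + pose proof Hs as (r & _ & _ & Hk & Hr & _). apply (H r); assumption.
    + pose proof Hs as (r & _ & _ & Hk & Hr & _). rewrite <- (Forall2_length Hxy) in Hr.
      apply (H r); assumption.
  - intros G k xs ys a b (x & f & _ & _ & Hf & HG) Hxy Hab.
    assert (H : forall r, L k = Some (true, r) -> length xs = r ->
      (sfun S0 k xs a <-> sfun S1 k ys b)).
    { intros r Hk Hr. assert (Hr' : length ys = r) by (rewrite <- (Forall2_length Hxy); assumption).
      destruct (num_exists HZ k) as [z Hz]. destruct (tuple_code_exists HZ xs) as [c Hc].
      destruct (tuple_code_exists HZ ys) as [c' Hc'].
      unfold S0, S1.
      rewrite (sfun_decode HZ L Hm0 Hk Hr Hz Hc), (sfun_decode HZ L Hm1 Hk Hr' Hz Hc').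
      destruct (HJ x f Hf) as [(_ & _ & Hi) _]. apply (Hi z c c').
      - exact (num_in_nonstandard HZ Hw Hz Hn Hns).
      - apply (@Forall2_corresponds X R HZ _ xs ys); [|assumption..].
        eapply Forall2_mono; [|exact Hxy]. intros a' b'. apply HG.
      - exact (Hsym _ Hk Hz).
      - apply HG. assumption. }
    split; intros Hs.
    + pose proof Hs as (r & _ & _ & Hk & Hr & _). apply (H r); assumption.
    + pose proof Hs as (r & _ & _ & Hk & Hr & _). rewrite <- (Forall2_length Hxy) in Hr.
      apply (H r); assumption.
  - exact (Hcod m0 u0 I0 Hm0 Hcod0).
  - exact (Hcod m1 u1 I1 Hm1 Hcod1).
  - intros G a (x & f & Hx & Hxs & Hf & HG) Ha. apply (sdom_decode HZ L Hm0) in Ha.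
    destruct (Hext x f Hx Hxs Hf) as (y & Hy & Hys & Hfo & _).
    destruct (Hfo a Ha) as (b & f' & _ & Hf' & Hs & Hab).
    exists (rel_in R f'), b. split; [|split; [|assumption]].
    + exists y, f'. repeat (split; [assumption|]). reflexivity.
    + intros a' b' H. apply Hs, HG, H.
  - intros G b (x & f & Hx & Hxs & Hf & HG) Hb. apply (sdom_decode HZ L Hm1) in Hb.
    destruct (Hext x f Hx Hxs Hf) as (y & Hy & Hys & _ & Hba).
    destruct (Hba b Hb) as (a & f' & _ & Hf' & Hs & Hab).
    exists (rel_in R f'), a. split; [|split; [|assumption]].
    + exists y, f'. repeat (split; [assumption|]). reflexivity.
    + intros a' b' H. apply Hs, HG, H.
Qed.

(** * Carrying types through the nonstandard system *)

Lemma card_lt_bijection A B K (g : A -> B) (g' : B -> A) :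
  (forall a, g' (g a) = a) -> (forall b, g (g' b) = b) -> card_lt A K -> card_lt B K.
Proof.
  intros Hg Hg' [[i Hi] Hno]. split.
  - exists (fun b => i (g' b)). intros x y H. apply Hi in H. rewrite <- (Hg' x), <- (Hg' y), H.
    reflexivity.
  - intros [i' Hi']. apply Hno. exists (fun x => g' (i' x)). intros x y H. apply Hi'.
    rewrite <- (Hg' (i' x)), <- (Hg' (i' y)), H. reflexivity.
Qed.

Lemma sig_eq (A : X -> Prop) (x y : {a : X | A a}) : proj1_sig x = proj1_sig y -> x = y.
Proof. destruct x, y; simpl. intros ->. f_equal. apply proof_irrelevance. Qed.

Theorem pseudosaturated_transfer K : omega_nonstandard R ->
  finitely_approximable R s u0 I0 u1 I1 ->
  pseudosaturated R S0 K -> pseudosaturated R S1 K.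
Proof.
  intros (w & x & Hw & Hx & Hns) Happ Hsat A HA (h & Hh & HAh) HK n p (Hpb & Hpc & Hpf).
  destruct (Happ w x h Hw Hx Hh) as (J & f & h0 & HJ & Hf & Hdom & Hh0 & Hran).
  pose proof (nonstandard_back_and_forth Hw Hx Hns HJ) as HB.
  assert (HG : nonstandard_map w J (rel_in R f)).
  { exists x, f. repeat (split; [assumption|]). reflexivity. }
  (* The preimage of [A] under [f]. As [f] is injective and covers [A], it is in bijection with [A],
     and it lies inside the internally finite [h0]. *)
  pose (A' := fun a => exists b, A b /\ rel_in R f a b).
  assert (Hg : forall b : {b : X | A b}, exists a : {a : X | A' a},
    rel_in R f (proj1_sig a) (proj1_sig b)).
  { intros [b Hb]. destruct (Hdom b) as [a Ha]; [auto|apply (sdom_decode HZ L Hm1), HA, Hb|].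
    assert (Ha' : A' a) by (exists b; auto). exists (exist _ a Ha'). assumption. }
  assert (Hg' : forall a : {a : X | A' a}, exists b : {b : X | A b},
    rel_in R f (proj1_sig a) (proj1_sig b)).
  { intros [a (b & Hb & Hab)]. exists (exist _ b Hb). assumption. }
  pose (g := fun b => proj1_sig (constructive_indefinite_description _ (Hg b))).
  pose (g' := fun a => proj1_sig (constructive_indefinite_description _ (Hg' a))).
  assert (Gg : forall b, rel_in R f (proj1_sig (g b)) (proj1_sig b))
    by (intros b; apply (proj2_sig (constructive_indefinite_description _ (Hg b)))).
  assert (Gg' : forall a, rel_in R f (proj1_sig a) (proj1_sig (g' a)))
    by (intros a; apply (proj2_sig (constructive_indefinite_description _ (Hg' a)))).
  clearbody g g'. clear Hg Hg'.
  assert (Kg : forall b, g' (g b) = b).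
  { intros b. apply sig_eq. apply (bf_eq HB HG (Gg' (g b)) (Gg b)). reflexivity. }
  assert (Kg' : forall a, g (g' a) = a).
  { intros a. apply sig_eq. apply (bf_eq HB HG (Gg (g' a)) (Gg' a)). reflexivity. }
  (* Taking the type as a preimage under renaming gives its completeness at once, since [fmap]
     commutes with [fneg] by computation. *)
  destruct (Hsat A') with (n := n) (p := fun phi => p (fmap g' phi)) as (e0 & He0 & Hreal).
  - intros a (b & _ & Hab). exact (proj1 (bf_dom HB HG Hab)).
  - exists h0. split; [assumption|]. intros a (b & _ & Hab). exact (Hran a b Hab).
  - exact (card_lt_bijection g g' Kg Kg' HK).
  - assert (Hb : forall phi, p (fmap g' phi) -> fbound n phi).
    { intros phi H. rewrite <- (fmap_inv g' g Kg' phi). apply fmap_bound, Hpb, H. }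
    split; [exact Hb|]. split.
    + intros phi H. apply (Hpc (fmap g' phi)). apply fmap_bound, H.
    + intros l Hl. destruct (Hpf (map (fmap g') l)) as (e1 & He1 & Hs).
      { intros phi H. apply in_map_iff in H. destruct H as (psi & <- & H). apply Hl, H. }
      (* For finite satisfiability, a solution [e1] in [S1] of the renamed formulas is pulled back
         by [n] back steps starting from [f]. *)
      destruct (back_and_forth_extend (back_and_forth_flip HB) e1 He1 n
        (G := fun b a => rel_in R f a b) HG) as (G & e0 & HG' & Hincl & He0 & Hmatch).
      exists e0. split; [assumption|]. intros phi Hphi.
      apply (back_and_forth_sat HB (v1 := fun a => proj1_sig (g' a)) phi (G := fun a b => G b a)
        (e1 := e1) (Hb phi (Hl phi Hphi)) HG').
      * split; [intros a; apply Hincl, Gg'|exact Hmatch].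
      * apply (sat_fmap S1 g' (@proj1_sig _ _)). apply Hs, in_map, Hphi.
  (* The realization found in [S0] is moved to [S1] by extending [f] again, which keeps the
     parameters matched. *)
  - destruct (back_and_forth_extend HB e0 He0 n HG) as (G & e1 & HG' & Hincl & He1 & Hmatch).
    exists e1. split; [assumption|]. intros phi Hphi.
    apply (back_and_forth_sat HB (v0 := fun b => proj1_sig (g b)) phi (e0 := e0) (Hpb phi Hphi) HG').
    + split; [intros b; apply Hincl, Gg|exact Hmatch].
    + apply (sat_fmap S0 g (@proj1_sig _ _)). apply Hreal.
      rewrite (fmap_inv g g' Kg). assumption.
Qed.

End Nonstandard.

(** * Transfer along the elementary embedding *)

Lemma elementary_opair U W (E : U -> U -> Prop) (F : W -> W -> Prop) j (Hj : elementary E F j)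
  p a b : opair E p a b -> opair F (j p) (j a) (j b).
Proof.
  apply (@elementary_transfer U W E F j Hj (fun X R e => opair R (e 0) (e 1) (e 2)))
    with (e := env p [p; a; b]).
  unfold opair, upair. definability.
Qed.

Lemma definable_symbol_kind d i i' : definable (fun X R e => symbol_kind R d (e i) (e i')).
Proof.
  pose proof definable_num. unfold symbol_kind, opair, upair. definability.
Qed.

Lemma pseudosaturated_elementary U (E : U -> U -> Prop) (HV : ZFCminus E) (HVwf : well_founded E)
  W (F : W -> W -> Prop) (HW : ZFCminus F) j (Hj : elementary E F j)
  (Hns : omega_nonstandard F) L T (HT : complete_theory L T) M0 M1
  (HM0 : is_Lstructure E L M0) (HM1 : is_Lstructure E L M1)
  (HT0 : models (decode E L M0) T) (HT1 : models (decode E L M1) T) K :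
  pseudosaturated F (j_std F j L M0) K -> pseudosaturated F (j_std F j L M1) K.
Proof.
  pose proof HM0 as ([s Hs] & u0 & I0 & Hm0 & _). pose proof HM1 as (_ & u1 & I1 & Hm1 & _).
  assert (Hcod : forall M u I, opair E M u I -> is_Lstructure E L M ->
    forall k r x c b, L k = Some (true, r) -> is_num F x k ->
    fun_holds F (j I) x c b -> F b (j u)).
  { intros M u I HM HLM k r x c b Hk Hx. destruct (num_exists HV k) as [z Hz].
    destruct (proj1 (@elementary_transfer U W E F j Hj
      (* Including [is_num] in the formula identifies the image of the numeral [z] with the numeral
         [x] of the target model; [k] is fixed, so one formula per symbol is enough. *)
      (fun X R e => is_num R (e 0) k /\
        forall c b, fun_holds R (e 1) (e 0) c b -> R b (e 2))
      ltac:(pose proof definable_num; unfold fun_holds, rel_in, opair, upair; definability)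
      (env z [z; I; u]))) as [Hz' H].
    - split; [assumption|]. simpl. intros c' b' H.
      exact (proj1 (fun_holds_spec HV HM HLM Hk Hz H)).
    - simpl in Hz', H. rewrite (num_unique HW Hx Hz'). apply H. }
  apply (pseudosaturated_transfer HW (s := j s) (elementary_opair Hj Hm0)
    (elementary_opair Hj Hm1)).
  - intros k kd r x Hk Hx. destruct (num_exists HV k) as [z Hz].
    destruct (proj1 (@elementary_transfer U W E F j Hj
      (fun X R e => is_num R (e 0) k /\ symbol_kind R (if kd then 1 else 0) (e 1) (e 0))
      ltac:(pose proof definable_num; pose proof definable_symbol_kind; definability)
      (env z [z; s]))) as [Hz' H].
    + split; [assumption|]. simpl. apply (symbol_kind_iff HV _ _ Hs). eauto 6.
    + simpl in Hz', H. rewrite (num_unique HW Hx Hz'). assumption.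
  - exact (Hcod M0 u0 I0 Hm0 HM0).
  - exact (Hcod M1 u1 I1 Hm1 HM1).
  - assumption.
  - apply (proj1 (@elementary_transfer U W E F j Hj
      (fun X R e => finitely_approximable R (e 0) (e 1) (e 2) (e 3) (e 4))
      (definable_finitely_approximable 0 1 2 3 4) (env s [s; u0; I0; u1; I1]))).
    exact (wf_finitely_approximable HV HVwf HT Hs Hm0 Hm1 HM0 HM1 HT0 HT1).
Qed.

Theorem mainTheorem1
  (U : Type) (E : U -> U -> Prop)          (* V, a transitive model of ZFC^- *)
  (HV : ZFCminus E) (HVwf : well_founded E)
  (W : Type) (F : W -> W -> Prop)          (* V-hat, a model of ZFC^- *)
  (HW : ZFCminus F)
  (j : U -> W) (Hj : elementary E F j)
  (Hns : omega_nonstandard F)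
  (L : lang) (T : sentence -> Prop) (HT : complete_theory L T)
  (M0 M1 : U)
  (HM0 : is_Lstructure E L M0) (HM1 : is_Lstructure E L M1)
  (HT0 : models (decode E L M0) T) (HT1 : models (decode E L M1) T)
  (K : Type) (HK : uncountable K) :
  pseudosaturated F (j_std F j L M0) K <-> pseudosaturated F (j_std F j L M1) K.
Proof. split; apply (pseudosaturated_elementary HV HVwf HW Hj Hns HT); assumption. Qed.
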